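(* For every dimension $d\ge 2$ and all parameters $\alpha\in(0,1]$, $\kappa\in(0,1]$, $\Lambda>0$ there exists a constant $C>0$, depending only on $d,\alpha,\kappa,\Lambda$, such that for every $\mathcal{S}^{2,\alpha}_{\kappa,\Lambda}$-domain $\Omega\subset\mathbb{R}^d$ with $|\Omega|=|B_1|$, $$\delta(\Omega)+\delta_{|x|^2}(\Omega)\ge C\,Z^\alpha(\Omega,B_1)^2,$$ where $\delta(\Omega)=|\partial\Omega|-|\partial B_1|$ and $\delta_{|x|^2}(\Omega)=\int_{\partial\Omega}|x|^2\,d\mathcal{H}^{d-1}(x)-|\partial B_1|$.
   Context: $B_1\subset\mathbb{R}^d$ is the unit ball centered at $0$, $|\cdot|$ of a set is Lebesgue measure, $\mathcal{H}^{d-1}$ is the $(d-1)$-dimensional Hausdorff measure, and $|\partial E|=\mathcal{H}^{d-1}(\partial E)$. Regularity class. Let $\Omega\subset\mathbb{R}^d$ be a bounded domain star-shaped with respect to $0$, described by a radius function $R:\mathbb{S}^{d-1}\to(0,\infty)$ via $\Omega=\{0\}\cup\{x\neq 0: 0<|x|<R(x/|x|)\}$. For $\alpha\in(0,1]$, $\kappa\in(0,1]$, $\Lambda>0$, $\Omega$ is called an $\mathcal{S}^{2,\alpha}_{\kappa,\Lambda}$-domain if: (i) $\Omega$ is a $C^{2,\alpha}$ domain; (ii) $\nu(x)\cdot\frac{x}{|x|}\ge\kappa$ for all $x\in\partial\Omega$, where $\nu$ is the unit outward normal of $\partial\Omega$; (iii) $\|R-1\|_{C^{1,\alpha}(\mathbb{S}^{d-1})}\le\Lambda$.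 The $\alpha$-Zolotarev distance is $$Z^\alpha(\Omega,B_1)=\sup_{h\in\mathcal{H}^\alpha}\left|\int_{B_1}h\,dx-\frac{|B_1|}{|\Omega|}\int_\Omega h\,dx\right|,\qquad \mathcal{H}^\alpha=\{h\in C^\alpha(\mathbb{R}^d):\|h\|_{C^\alpha(\mathbb{R}^d)}\le 1\},$$ where $\|h\|_{C^\alpha}=\sup|h|+\sup_{x\ne y}\frac{|h(x)-h(y)|}{|x-y|^\alpha}$ is the usual Hölder norm (Lipschitz when $\alpha=1$). *)

(* Defs.v *)
(* R^d is 'rV[R]_d for R : realType. *)
From HB Require Import structures.
From mathcomp Require Import all_boot all_order all_algebra.
From mathcomp Require Import all_classical all_reals all_analysis.
Set Implicit Arguments.
Unset Strict Implicit.
Unset Printing Implicit Defensive.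
Import Order.TTheory GRing.Theory Num.Theory.
Import numFieldNormedType.Exports.
Local Open Scope classical_set_scope.
Local Open Scope ring_scope.

(* The library norm on 'rV[R]_d is the sup norm, so the Euclidean norm is
   defined here; both induce the same topology and bounded sets. *)
Section euclidean.
Context {R : realType} {d : nat}.
Implicit Types (x y : 'rV[R]_d) (A : set 'rV[R]_d).

Definition dot x y : R := \sum_i x ord0 i * y ord0 i.

Definition enorm x : R := Num.sqrt (dot x x).

Definition eball x (r : R) : set 'rV[R]_d := [set y | enorm (y - x) < r].

Definition unit_ball : set 'rV[R]_d := eball 0 1.

Definition unit_sphere : set 'rV[R]_d := [set x | enorm x = 1].

Definition boundary A : set 'rV[R]_d := closure A `\` A°.

Definition normalize x : 'rV[R]_d := (enorm x)^-1 *: x.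

Lemma enorm0 : enorm 0 = 0.
Proof.
by rewrite /enorm /dot big1 ?sqrtr0// => i _; rewrite mxE mul0r.
Qed.

End euclidean.

(* 'rV[R]_d carries the sigma-algebra generated by the coordinates, i.e. the
   Borel sigma-algebra. *)
Definition row_display : measure_display.
Proof. exact: default_measure_display. Qed.

Section row_measurable.
Context {R : realType} {d : nat}.

Let coord (i : 'I_d) (x : 'rV[R]_d) : R := x ord0 i.

Let row_set0 : g_sigma_preimage coord set0.
Proof. exact: sigma_algebra0. Qed.

Let row_setC A : g_sigma_preimage coord A -> g_sigma_preimage coord (~` A).
Proof. exact: sigma_algebraC. Qed.

Let row_bigcup (F : _^nat) : (forall i, g_sigma_preimage coord (F i)) ->
  g_sigma_preimage coord (\bigcup_i (F i)).
Proof. exact: sigma_algebra_bigcup. Qed.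

HB.instance Definition _ := @isMeasurable.Build row_display
  'rV[R]_d (g_sigma_preimage coord) row_set0 row_setC row_bigcup.

End row_measurable.

(* Lebesgue measure on R^d, by induction on d: on R^(n+1) it is the image of
   the product of the one-dimensional Lebesgue measure and the Lebesgue measure
   on R^n under (t, x) |-> (t, x). *)
Section lebesgue_row.
Context {R : realType}.

Definition cons_row n (p : R * 'rV[R]_n) : 'rV[R]_n.+1 := row_mx p.1%:M p.2.

Lemma cons_row0 n (p : R * 'rV[R]_n) : cons_row p ord0 ord0 = p.1.
Proof.
rewrite /cons_row (_ : (ord0 : 'I_n.+1) = lshift n (ord0 : 'I_1)); last exact/val_inj.
by rewrite [LHS]row_mxEl mxE eqxx mulr1n.
Qed.

Lemma cons_rowS n (p : R * 'rV[R]_n) (i : 'I_n) :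
  cons_row p ord0 (lift ord0 i) = p.2 ord0 i.
Proof.
rewrite /cons_row (_ : lift ord0 i = rshift 1 i); last exact/val_inj.
by rewrite [LHS]row_mxEr.
Qed.

Lemma measurable_row_coord n (i : 'I_n) :
  measurable_fun [set: 'rV[R]_n] (fun x : 'rV[R]_n => x ord0 i).
Proof.
move=> _ Y mY; rewrite setTI; apply: sub_sigma_algebra => /=.
rewrite -bigcup_seq/=; exists i => /=; first by rewrite mem_index_enum.
by exists Y => //; rewrite setTI.
Qed.

Lemma measurable_fun_row d (T : measurableType d) n (f : T -> 'rV[R]_n) :
  (forall i, measurable_fun [set: T] (fun t => f t ord0 i)) ->
  measurable_fun [set: T] f.
Proof.
move=> mf.
pose c := fun (i : 'I_n) (x : 'rV[R]_n) => x ord0 i.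
have h : g_sigma_preimage (fun i => c i \o f) `<=` measurable.
  apply: smallest_sub; first exact: sigma_algebra_measurable.
  move=> A; rewrite -bigcup_seq/= => -[i _ [B mB <-]].
  exact: mf.
move=> _ A mA; apply: h; rewrite g_sigma_preimage_comp.
by exists A.
Qed.

Lemma measurable_cons_row n : measurable_fun [set: R * 'rV[R]_n] (@cons_row n).
Proof.
apply: measurable_fun_row => i.
have [j ->|->] := unliftP ord0 i; last first.
- under eq_fun do rewrite cons_row0.
  exact: measurable_fst.
- under eq_fun do rewrite cons_rowS.
  exact: (measurableT_comp (measurable_row_coord j) measurable_snd).
Qed.

Definition uncons_row n (x : 'rV[R]_n.+1) : R * 'rV[R]_n :=
  (x ord0 ord0, \row_i x ord0 (lift ord0 i)).

Lemma cons_rowK n : cancel (@cons_row n) (@uncons_row n).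
Proof.
move=> [t x]; rewrite /uncons_row cons_row0; congr (_, _).
by apply/rowP => i; rewrite mxE cons_rowS.
Qed.

Lemma measurable_uncons_row n : measurable_fun [set: 'rV[R]_n.+1] (@uncons_row n).
Proof.
apply: measurable_fun_pair; first exact: measurable_row_coord.
apply: measurable_fun_row => i; under eq_fun do rewrite mxE.
exact: measurable_row_coord.
Qed.

Section step.
Context {n : nat} (m : {sigma_finite_measure set 'rV[R]_n -> \bar R}).

Definition lebesgue_step : set 'rV[R]_n.+1 -> \bar R :=
  pushforward (@lebesgue_measure R \x m)%E (@cons_row n).

Let mstep : {measure set 'rV[R]_n.+1 -> \bar R} :=
  measure_function_pushforward__canonical__measure_function_Measure
    (@lebesgue_measure R \x m)%E (@measurable_cons_row n).

Let step0 : (lebesgue_step set0 = 0)%E. Proof. exact: (measure0 mstep). Qed.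

Let step_ge0 A : (0 <= lebesgue_step A)%E.
Proof. exact: (measure_ge0 mstep). Qed.

Let step_sigma_additive : semi_sigma_additive lebesgue_step.
Proof. exact: (@measure_semi_sigma_additive _ _ _ mstep). Qed.

HB.instance Definition _ := isMeasure.Build _ _ _ lebesgue_step
  step0 step_ge0 step_sigma_additive.

Let step_sigma_finite : sigma_finite setT lebesgue_step.
Proof.
have /sigma_finiteP[F [FT ndF Foo]] := sigma_finiteT (@lebesgue_measure R).
have /sigma_finiteP[G [GT ndG Goo]] := sigma_finiteT m.
exists (fun k => @uncons_row n @^-1` (F k `*` G k)).
  rewrite -preimage_bigcup (_ : \bigcup_k _ = setT) ?preimage_setT//.
  rewrite -setXTT FT GT predeqE => -[x y]; split.
    by move=> [k _ []/= ? ?]; split; exists k.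
  move=> [/= [k _ Fkx] [l _ Gly]]; exists (maxn k l) => //; split.
  - by move: x Fkx; exact/subsetPset/ndF/leq_maxl.
  - by move: y Gly; exact/subsetPset/ndG/leq_maxr.
move=> k; have [mF Fk] := Foo k; have [mG Gk] := Goo k; split.
  rewrite -[X in measurable X]setTI.
  by apply: measurable_uncons_row => //; exact: measurableX.
rewrite /lebesgue_step /pushforward -comp_preimage.
rewrite (_ : @uncons_row n \o @cons_row n = id); last exact/funext/cons_rowK.
by rewrite preimage_id product_measure1E// lte_mul_pinfty// ge0_fin_numE.
Qed.

HB.instance Definition _ := Measure_isSigmaFinite.Build _ _ _ lebesgue_step
  step_sigma_finite.

End step.

Fixpoint lebesgue_row n : {sigma_finite_measure set 'rV[R]_n -> \bar R} :=
  match n with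
  | 0 => dirac (0 : 'rV[R]_0)
  | n'.+1 => lebesgue_step (lebesgue_row n')
  end.

End lebesgue_row.

(* Auxiliary copy of T in which every set is measurable, to reuse mu_ext for
   covers by arbitrary sets. *)
Definition discrete_copy (T : Type) : Type := T.

Section discrete_copy.
Context (T : pointedType).

Let all0 : (@setT (set T)) set0. Proof. by []. Qed.
Let allC (A : set T) : setT A -> setT (~` A). Proof. by []. Qed.
Let allU (F : (set T)^nat) : (forall i, setT (F i)) -> setT (\bigcup_i F i).
Proof. by []. Qed.

HB.instance Definition _ := Pointed.on (discrete_copy T).
HB.instance Definition _ := @isMeasurable.Build default_measure_display
  (discrete_copy T) setT all0 allC allU.

End discrete_copy.

Section hausdorff.
Local Open Scope ereal_scope.
Context {R : realType} {d : nat}.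
Implicit Types (A : set 'rV[R]_d) (s : nat) (delta : R).

Definition diam A : \bar R :=
  ereal_sup [set (enorm (x - y))%:E | x in A & y in A].

(* omega_s (diam A / 2)^s with omega_s = |B_1| in R^s, so that s-dimensional
   Hausdorff measure agrees with s-dimensional area. *)
Definition hausdorff_gauge s A : \bar R :=
  if A == set0 then 0
  else @lebesgue_row R s unit_ball * (diam A * (2^-1)%:E) ^+ s.

Definition hausdorff_pre s delta A : \bar R :=
  ereal_inf [set \sum_(k <oo) hausdorff_gauge s (F k) |
    F in [set F : (set 'rV[R]_d)^nat |
      A `<=` \bigcup_k F k /\ forall k, diam (F k) <= delta%:E]].

Definition hausdorff s A : \bar R :=
  ereal_sup [set hausdorff_pre s delta A | delta in [set r : R | (0 < r)%R]].

Lemma diam_ge0 A : A !=set0 -> 0 <= diam A.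
Proof.
move=> [x Ax]; apply: ereal_sup_ubound; exists x => //; exists x => //.
by rewrite subrr enorm0.
Qed.

Lemma diam_set0 : diam set0 = -oo.
Proof.
rewrite -ereal_sup0 /diam; congr ereal_sup.
by apply/seteqP; split => [_ [x []]|].
Qed.

Lemma hausdorff_gauge_ge0 s A : 0 <= hausdorff_gauge s A.
Proof.
rewrite /hausdorff_gauge; case: ifPn => // /set0P A0.
by rewrite mule_ge0// expe_ge0// mule_ge0 ?diam_ge0.
Qed.

Definition hausdorff_cutoff s delta (A : set (discrete_copy 'rV[R]_d)) :
    \bar R :=
  if diam A <= delta%:E then hausdorff_gauge s A else +oo.

Lemma hausdorff_cutoff_ge0 s delta A : 0 <= hausdorff_cutoff s delta A.
Proof.
by rewrite /hausdorff_cutoff; case: ifPn => // _; exact: hausdorff_gauge_ge0.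
Qed.

Lemma hausdorff_cutoff0 s delta : hausdorff_cutoff s delta set0 = 0.
Proof. by rewrite /hausdorff_cutoff diam_set0 leNye /hausdorff_gauge eqxx. Qed.

#[local] Hint Resolve hausdorff_cutoff_ge0 hausdorff_cutoff0 : core.

Lemma hausdorff_preE s delta :
  hausdorff_pre s delta = mu_ext (hausdorff_cutoff s delta).
Proof.
apply/funext => A; apply/eqP; rewrite eq_le; apply/andP; split.
- apply: le_ereal_inf_tmp => _ [F [_ AF] <-].
  have [dF|/existsNP[k dF]] := pselect (forall k, diam (F k) <= delta%:E).
    apply: ereal_inf_lbound; exists F => //.
    by apply: eq_eseriesr => k _; rewrite /hausdorff_cutoff dF.
  rewrite (@eseries_pinfty _ _ _ k) ?leey//.
    by move=> j _; rewrite -ltNye (lt_le_trans _ (hausdorff_cutoff_ge0 _ _ _)).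
  by rewrite /hausdorff_cutoff ifN//; exact/negP.
- apply: le_ereal_inf_tmp => _ [F [AF dF] <-].
  apply: ereal_inf_lbound; exists F => //.
  by apply: eq_eseriesr => k _; rewrite /hausdorff_cutoff dF.
Qed.

Lemma hausdorff0 s : hausdorff s set0 = 0.
Proof.
rewrite /hausdorff (_ : [set _ | _ in _] = [set 0]) ?ereal_sup1//.
apply/seteqP; split => [_ [r r0 <-]|_ ->] /=.
  by rewrite hausdorff_preE; apply: mu_ext0.
by exists 1%R => //; rewrite hausdorff_preE; apply: mu_ext0.
Qed.

Lemma hausdorff_ge0 s A : 0 <= hausdorff s A.
Proof.
apply: le_trans (ereal_sup_ubound _); last by exists 1%R => //=.
by rewrite hausdorff_preE; apply: mu_ext_ge0.
Qed.

Lemma le_hausdorff s : {homo hausdorff s : A B / A `<=` B >-> A <= B}.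
Proof.
move=> A B AB; apply: ge_ereal_sup => _ [r r0 <-].
apply: le_trans (ereal_sup_ubound _); last by exists r.
by rewrite hausdorff_preE le_mu_ext.
Qed.

Lemma hausdorff_sigma_subadditive s : sigma_subadditive (hausdorff s).
Proof.
move=> F; apply: ge_ereal_sup => _ [r r0 <-].
rewrite hausdorff_preE; apply: (@le_trans _ _ (\sum_(k <oo) hausdorff_pre s r (F k))).
  by rewrite hausdorff_preE; apply: mu_ext_sigma_subadditive.
apply: lee_nneseries => k _; first by rewrite hausdorff_preE mu_ext_ge0.
by apply: ereal_sup_ubound; exists r.
Qed.

HB.instance Definition _ s := isOuterMeasure.Build R 'rV[R]_d (hausdorff s)
  (hausdorff0 s) (@hausdorff_ge0 s) (@le_hausdorff s)
  (@hausdorff_sigma_subadditive s).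

End hausdorff.

(* Integral over A with respect to s-dimensional Hausdorff measure on its
   sigma-algebra of Caratheodory measurable sets. *)
Definition hausdorff_integral {R : realType} {d : nat} (s : nat)
    (A : set 'rV[R]_d) (f : 'rV[R]_d -> R) : \bar R :=
  (\int[(hausdorff s : set (caratheodory_type (hausdorff s)) -> \bar R)]_(x in A)
    (f x)%:E)%E.

Section hoelder_norms.
Local Open Scope ereal_scope.
Context {R : realType} {d : nat}.
Implicit Types (D : set 'rV[R]_d) (alpha : R).

Definition sup_norm (V : zmodType) (N : V -> R) D (f : 'rV[R]_d -> V) : \bar R :=
  ereal_sup [set (N (f x))%:E | x in D].

Definition hoelder_seminorm (V : zmodType) (N : V -> R) alpha D
    (f : 'rV[R]_d -> V) : \bar R :=
  ereal_sup [set (N (f p.1 - f p.2) / enorm (p.1 - p.2) `^ alpha)%:E |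
    p in [set p : 'rV[R]_d * 'rV[R]_d | [/\ D p.1, D p.2 & p.1 != p.2]]].

Definition hoelder_norm alpha (h : 'rV[R]_d -> R) : \bar R :=
  sup_norm Num.norm setT h + hoelder_seminorm Num.norm alpha setT h.

Definition partial (i : 'I_d) (f : 'rV[R]_d -> R) (x : 'rV[R]_d) : R :=
  'D_(delta_mx ord0 i) f x.

Definition grad (f : 'rV[R]_d -> R) (x : 'rV[R]_d) : 'rV[R]_d :=
  \row_i partial i f x.

(* A function f on the unit sphere is differentiated through its 0-homogeneous
   extension, whose gradient at a point of the sphere is the tangential
   gradient of f. *)
Definition sphere_ext (f : 'rV[R]_d -> R) : 'rV[R]_d -> R :=
  fun x => f (normalize x).

Definition sphere_C1 (f : 'rV[R]_d -> R) : Prop :=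
  forall x, unit_sphere x -> differentiable (sphere_ext f) x.

Definition sphere_C1alpha_norm alpha (f : 'rV[R]_d -> R) : \bar R :=
  sup_norm Num.norm unit_sphere f
  + sup_norm enorm unit_sphere (grad (sphere_ext f))
  + hoelder_seminorm enorm alpha unit_sphere (grad (sphere_ext f)).

Definition C2alpha_on alpha D (f : 'rV[R]_d -> R) : Prop :=
  [/\ forall x, D x -> differentiable f x,
      forall i x, D x -> differentiable (partial i f) x &
      forall i j, hoelder_seminorm Num.norm alpha D (partial j (partial i f)) < +oo].

End hoelder_norms.

Section domains.
Context {R : realType} {d : nat}.
Implicit Types (Omega : set 'rV[R]_d) (alpha kappa Lambda : R).

(* Near x, Omega is the part of space above the graph, in the direction of the
   unit vector e, of the function g.  Here g is a function on the hyperplane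
   orthogonal to e, extended to R^d constantly along e. *)
Definition graph_chart Omega (x e : 'rV[R]_d) (g : 'rV[R]_d -> R) (r : R) : Prop :=
  [/\ 0 < r,
      enorm e = 1,
      forall y t, g (y + t *: e) = g y &
      forall y, eball x r y -> (Omega y <-> g y < dot y e)].

Definition C2alpha_domain alpha Omega : Prop :=
  [/\ open Omega, connected Omega & forall x, boundary Omega x ->
    exists e g r, graph_chart Omega x e g r /\ C2alpha_on alpha (eball x r) g].

(* grad g - e points out of Omega, where Omega is locally {g y - dot y e < 0}. *)
Definition unit_outward_normal Omega (x nu : 'rV[R]_d) : Prop :=
  exists e g r, [/\ graph_chart Omega x e g r,
    forall y, eball x r y -> differentiable g y & nu = normalize (grad g x - e)].

Definition radial_domain (rho : 'rV[R]_d -> R) : set 'rV[R]_d :=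
  [set x | x = 0 \/ (0 < enorm x < rho (normalize x))].

(* Only the values of rho on the unit sphere matter. *)
Definition S2alpha_domain alpha kappa Lambda Omega : Prop :=
  [/\ bounded_set Omega,
      C2alpha_domain alpha Omega,
      forall x nu, boundary Omega x -> unit_outward_normal Omega x nu ->
        kappa <= dot nu (normalize x) &
      exists rho : 'rV[R]_d -> R,
        [/\ forall x, unit_sphere x -> 0 < rho x,
            Omega = radial_domain rho,
            sphere_C1 (fun x => rho x - 1) &
            (sphere_C1alpha_norm alpha (fun x => rho x - 1)%R <= Lambda%:E)%E]].

End domains.

Section functionals.
Context {R : realType} {d : nat}.
Implicit Types (Omega E : set 'rV[R]_d) (alpha : R).

Definition volume Omega : \bar R := lebesgue_row d Omega.

Definition perimeter Omega : \bar R := hausdorff d.-1 (boundary Omega).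

Definition deficit Omega : \bar R := (perimeter Omega - perimeter unit_ball)%E.

Definition weighted_deficit Omega : \bar R :=
  (hausdorff_integral d.-1 (boundary Omega) (fun x => enorm x ^+ 2)%R
   - perimeter unit_ball)%E.

Definition zolotarev alpha Omega E : \bar R :=
  ereal_sup [set (`| \int[lebesgue_row d]_(x in E) h x
      - fine (volume E) / fine (volume Omega)
        * \int[lebesgue_row d]_(x in Omega) h x |)%:E |
    h in [set h : 'rV[R]_d -> R | (hoelder_norm alpha h <= 1)%E]].

End functionals.

(* Main.v *)
(* Let s = d - 1, let S be the unit sphere and write Omega = {|x| < rho(x/|x|)}.
   The radial projection of the boundary of Omega onto S is (1/r)-Lipschitz
   outside the ball of radius r, so that, without any area formula,
     H^s(bd Omega) + int_(bd Omega) |x|^2 dH^s >= int_S (1 + rho^2) rho^s dH^s.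
   On S the measure H^s is a multiple q of the cone measure
   mu(A) = |{0 < |x| < 1, x/|x| in A}|: both are finite, and by invariance under
   reflections the measure of a cap depends only on its radius; two such
   measures are proportional on open sets, as one sees by integrating
   the indicator of |x - y| < r in both orders (Christensen).  The reflection
   invariance of Lebesgue measure itself is obtained in the same way.  The value
   of q is irrelevant.

   Since |Omega| = |B| reads int_S rho^d dmu = mu(S), the right-hand side minus
   2 q mu(S) = 2 H^s(S) is at least q int_S (1 - rho)^2 rho^s dmu, which
   controls the square of int_S (rho^d - 1)_+ dmu = |Omega \ B| because
   rho <= 1 + Lambda.  Finally the Zolotarev distance is at most 2 |Omega \ B|.
   The integrals over S are replaced by finite sums over the slices
   {k/N < rho <= (k+1)/N}, with N tending to infinity at the end. *)
Require Import Defs.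
From HB Require Import structures.
From mathcomp Require Import all_boot all_order all_algebra.
From mathcomp Require Import all_classical all_reals all_analysis.
From mathcomp Require Import measurable_realfun ring lra.
Set Implicit Arguments.
Unset Strict Implicit.
Unset Printing Implicit Defensive.
Import Order.TTheory GRing.Theory Num.Theory.
Import numFieldNormedType.Exports.
Local Open Scope classical_set_scope.
Local Open Scope ring_scope.

(** * Euclidean geometry of row vectors *)

(** Lipschitz maps bound Hausdorff measure from one side only, and the proof is arranged so that
    this side suffices: the boundary of [Omega] is bounded below through its projection, and the
    perimeter of the ball above by the measure of the sphere. As [H^s] and the cone measure are
    compared on open sets, the slices are differences of open sets cut out by dilations of [Omega].
    The two deficits are added because [1 + r^2 >= 2 r] turns the surface density [r^s] into the
    volume density [r^(s+1)], whose integral is prescribed. Of the remainder [(1 - r)^2 r^s] only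
    the part with [r > 1] is kept: there [r^s >= 1], whereas the weight degenerates for small [r].
    Nothing is lost, because equal volumes force [|Omega \ B| = |B \ Omega|]. With [M = 1 + Lambda],
    [D = (s+1) (M+1)^s] and [b = |B|] the final constant is [q / (4 D^2 b)]: [D] is a Lipschitz
    constant of [r^(s+1)] on [[0, M+1]], [1 / b] comes from Cauchy-Schwarz and [1 / 4] from the
    bound of the Zolotarev distance by [2 |Omega \ B|]. Energies are evaluated at the lower end of a
    slice and volumes at the upper end; the mismatch is linear in the thickness. *)

Section euclidean_geometry.
Context {R : realType} {d : nat}.
Implicit Types (x y z : 'rV[R]_d) (r a : R).

Lemma dotC x y : dot x y = dot y x.
Proof. by apply: eq_bigr => i _; rewrite mulrC. Qed.

Lemma dotDl x y z : dot (x + y) z = dot x z + dot y z.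
Proof. by rewrite -big_split/=; apply: eq_bigr => i _; rewrite mxE mulrDl. Qed.

Lemma dotZl a x y : dot (a *: x) y = a * dot x y.
Proof. by rewrite mulr_sumr; apply: eq_bigr => i _; rewrite mxE mulrA. Qed.

Lemma dot0l x : dot 0 x = 0.
Proof. by rewrite -(scale0r x) dotZl mul0r. Qed.

Lemma dotNl x y : dot (- x) y = - dot x y.
Proof. by rewrite -scaleN1r dotZl mulN1r. Qed.

Lemma dotDr x y z : dot x (y + z) = dot x y + dot x z.
Proof. by rewrite dotC dotDl !(dotC x). Qed.

Lemma dotZr a x y : dot x (a *: y) = a * dot x y.
Proof. by rewrite dotC dotZl dotC. Qed.

Lemma dotNr x y : dot x (- y) = - dot x y.
Proof. by rewrite dotC dotNl dotC. Qed.

Lemma dot_ge0 x : 0 <= dot x x.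
Proof. by apply: sumr_ge0 => i _; rewrite -expr2 sqr_ge0. Qed.

Lemma enorm_ge0 x : 0 <= enorm x. Proof. exact: sqrtr_ge0. Qed.

Lemma sqr_enorm x : enorm x ^+ 2 = dot x x.
Proof. by rewrite sqr_sqrtr// dot_ge0. Qed.

Lemma enormN x : enorm (- x) = enorm x.
Proof. by rewrite /enorm dotNl dotNr opprK. Qed.

Lemma enormB x y : enorm (x - y) = enorm (y - x).
Proof. by rewrite -enormN opprB. Qed.

Lemma enormZ a x : enorm (a *: x) = `|a| * enorm x.
Proof.
by rewrite /enorm dotZl dotZr mulrA -expr2 sqrtrM ?sqr_ge0// sqrtr_sqr.
Qed.

Lemma ler_coord_enorm x i : `|x ord0 i| <= enorm x.
Proof.
rewrite -sqrtr_sqr ler_wsqrtr// /dot (bigD1 i)//= -expr2 lerDl.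
by apply: sumr_ge0 => j _; rewrite -expr2 sqr_ge0.
Qed.

Lemma enorm_eq0 x : (enorm x == 0) = (x == 0).
Proof.
apply/idP/eqP => [/eqP x0|->]; last by rewrite enorm0.
apply/rowP => i; rewrite mxE; apply/eqP; rewrite -normr_le0 -x0.
exact: ler_coord_enorm.
Qed.

Lemma enorm_gt0 x : (0 < enorm x) = (x != 0).
Proof. by rewrite lt0r enorm_eq0 enorm_ge0 andbT. Qed.

Lemma dot_le_enorm x y : dot x y <= enorm x * enorm y.
Proof.
have [->|x0] := eqVneq x 0; first by rewrite dot0l enorm0 mul0r.
have [->|y0] := eqVneq y 0; first by rewrite dotC dot0l enorm0 mulr0.
have ex : 0 < enorm x by rewrite enorm_gt0.
have ey : 0 < enorm y by rewrite enorm_gt0.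
have := dot_ge0 (enorm y *: x - enorm x *: y).
rewrite dotDl !dotDr !dotNl !dotNr !dotZl !dotZr (dotC y x) -!sqr_enorm.
have : 0 < enorm x * enorm y by rewrite mulr_gt0.
move: (enorm x) (enorm y) (dot x y) => a b c; nra.
Qed.

Lemma ler_enormD x y : enorm (x + y) <= enorm x + enorm y.
Proof.
rewrite -(@ler_pXn2r _ 2)// ?nnegrE ?addr_ge0 ?enorm_ge0//.
rewrite sqr_enorm dotDl !dotDr (dotC y x) sqrrD !sqr_enorm.
by have := dot_le_enorm x y; lra.
Qed.

Lemma ler_dist_enorm x y : `|enorm x - enorm y| <= enorm (x - y).
Proof.
have h (u v : 'rV[R]_d) : enorm u - enorm v <= enorm (u - v).
  by rewrite lerBlDr; have := ler_enormD (u - v) v; rewrite subrK.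
by rewrite ler_norml h lerNl opprB enormB h.
Qed.

Lemma ler_coord_norm x i : `|x ord0 i| <= `|x|.
Proof.
rewrite [leRHS]mx_normrE.
exact: (le_bigmax _ (fun ij : 'I_1 * 'I_d => `|x ij.1 ij.2|) (ord0, i)).
Qed.

Lemma enorm_le_coord x a : 0 <= a -> (forall i, `|x ord0 i| <= a) ->
  enorm x <= Num.sqrt d%:R * a.
Proof.
move=> a0 xa; rewrite -[a]ger0_norm// -sqrtr_sqr -sqrtrM// ler_wsqrtr//.
apply: (@le_trans _ _ (\sum_(i < d) a ^+ 2)); last first.
  by rewrite sumr_const card_ord mulr_natl.
apply: ler_sum => i _; rewrite -expr2 -[leLHS]real_normK ?num_real//.
by rewrite lerXn2r ?nnegrE.
Qed.

Lemma enorm_le_norm x : enorm x <= Num.sqrt d%:R * `|x|.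
Proof. by apply: enorm_le_coord => // i; exact: ler_coord_norm. Qed.

Lemma norm_le_enorm x : `|x| <= enorm x.
Proof.
change (mx_norm x <= enorm x); have [->|/mx_norm_neq0[[i j] ->]] := eqVneq (mx_norm x) 0.
  exact: enorm_ge0.
by rewrite (ord1 i) ler_coord_enorm.
Qed.

Lemma normalizeZ r x : 0 < r -> normalize (r *: x) = normalize x.
Proof.
move=> r0; rewrite /normalize enormZ gtr0_norm// invfM scalerA mulrAC.
by rewrite mulVf ?mul1r// gt_eqF.
Qed.

Lemma normalize_sphere x : unit_sphere x -> normalize x = x.
Proof. by move=> x1; rewrite /normalize x1 invr1 scale1r. Qed.

Lemma enorm_normalize x : x != 0 -> enorm (normalize x) = 1.
Proof.
by move=> x0; rewrite enormZ normfV ger0_norm ?enorm_ge0// mulVf// enorm_eq0.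
Qed.

Lemma normalizeE x : x = enorm x *: normalize x.
Proof.
have [->|x0] := eqVneq x 0; first by rewrite enorm0 scale0r.
by rewrite scalerA mulfV ?scale1r// enorm_eq0.
Qed.

(* Writing [x = |x| u] and [y = |y| v],
   [|x - y|^2 = (|x| - |y|)^2 + |x| |y| |u - v|^2]. *)
Lemma normalize_contract r x y : 0 < r -> r <= enorm x -> r <= enorm y ->
  r * enorm (normalize x - normalize y) <= enorm (x - y).
Proof.
move=> r0 rx ry.
have x0 : x != 0 by rewrite -enorm_gt0 (lt_le_trans r0).
have y0 : y != 0 by rewrite -enorm_gt0 (lt_le_trans r0).
rewrite -(@ler_pXn2r _ 2)// ?nnegrE ?mulr_ge0 ?enorm_ge0 ?(ltW r0)//.
rewrite exprMn {2}(normalizeE x) {2}(normalizeE y).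
have u1 := sqr_enorm (normalize x); have v1 := sqr_enorm (normalize y).
move: u1 v1; rewrite !enorm_normalize// expr1n !sqr_enorm.
move: rx ry; move: (enorm x) (enorm y) (normalize x) (normalize y) => a b u v ra rb u1 v1.
rewrite !dotDl !dotDr !dotNl !dotNr !dotZl !dotZr (dotC v u) -u1 -v1.
have c0 : 0 <= 1 - dot u v.
  have := dot_ge0 (u - v).
  by rewrite dotDl !dotDr !dotNl !dotNr (dotC v u) -u1 -v1; lra.
have : 0 <= (a * b - r ^+ 2) * (1 - dot u v).
  by rewrite mulr_ge0// subr_ge0 expr2 ler_pM// ltW.
by have := sqr_ge0 (a - b); lra.
Qed.

End euclidean_geometry.

(** * Topology and Borel sets in terms of the Euclidean norm *)

Section euclidean_topology.
Context {R : realType} {d : nat}.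
Implicit Types (x y : 'rV[R]_d) (U : set 'rV[R]_d) (r : R).

Lemma lipschitz1_continuous (f : 'rV[R]_d -> R) :
  (forall x y, `|f x - f y| <= enorm (x - y)) -> continuous f.
Proof.
move=> fl x; apply/(@cvgrPdist_lt _ _ _ (nbhs x) (nbhs_filter x)) => e e0.
(* The summand 1 keeps this factor positive when [d = 0]. *)
have s0 : 0 < Num.sqrt d%:R + 1 :> R by rewrite ltr_wpDl// sqrtr_ge0.
near=> y; rewrite (le_lt_trans (fl x y))// (le_lt_trans (enorm_le_norm _))//.
rewrite (le_lt_trans (y := (Num.sqrt d%:R + 1) * `|x - y|))//.
  by rewrite ler_wpM2r// lerDl.
rewrite mulrC -ltr_pdivlMr//.
near: y; apply: cvgr_dist_lt; last by rewrite divr_gt0.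
exact: cvg_id.
Unshelve. all: by end_near. Qed.

Lemma enorm_continuous : continuous (@enorm R d).
Proof. exact/lipschitz1_continuous/ler_dist_enorm. Qed.

Lemma continuous_enorm_sub x : continuous (fun y => enorm (y - x)).
Proof.
apply: lipschitz1_continuous => y z.
by rewrite (le_trans (ler_dist_enorm _ _))// opprB addrA subrK.
Qed.

Lemma open_eball x r : open (eball x r).
Proof.
rewrite (_ : eball x r = (fun y => enorm (y - x)) @^-1` [set t | t < r])//.
by apply: open_comp; [move=> y _; exact: continuous_enorm_sub|exact: open_lt].
Qed.

(** The two norms being equivalent, the cubes of the library topology can be traded for Euclidean
    balls; later openness proofs rely on this form. *)
Lemma open_eballP U : open U <->
  forall x, U x -> exists2 e, 0 < e & eball x e `<=` U.
Proof.
split=> [oU x Ux|UP].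
  have /nbhs_ballP[e /= e0 eU] := open_nbhs_nbhs (conj oU Ux).
  exists e => // y xy; apply: eU; rewrite -ball_normE/= distrC.
  exact: le_lt_trans (norm_le_enorm _) xy.
rewrite openE => x /UP[e e0 eU]; rewrite /interior.
apply: (filterS eU); apply: open_nbhs_nbhs; split; first exact: open_eball.
by rewrite /eball/= subrr enorm0.
Qed.

Lemma eball_center x r : 0 < r -> eball x r x.
Proof. by move=> r0; rewrite /eball/= subrr enorm0. Qed.

Lemma eballC x y r : eball x r y <-> eball y r x.
Proof. by rewrite /eball/= enormB. Qed.

(** This inclusion bounds the perimeter of the ball from above, which is the useful direction: that
    perimeter is subtracted in both deficits. *)
Lemma boundary_unit_ball : boundary (@unit_ball R d) `<=` unit_sphere.
Proof.
move=> x [cx nx]; apply/eqP; rewrite eq_le; apply/andP; split.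
  rewrite leNgt; apply/negP => x1.
  have : nbhs x [set y | 1 < enorm y].
    apply: open_nbhs_nbhs; split => //.
    by apply: (open_comp _ (@open_gt R 1)) => y _; exact: enorm_continuous.
  move=> /cx[y [+ y1]]; rewrite /unit_ball /eball/= subr0 => /ltW.
  by rewrite leNgt y1.
rewrite leNgt; apply/negP => x1; apply: nx; apply: open_nbhs_nbhs.
by split; [exact: open_eball|rewrite /unit_ball /eball/= subr0].
Qed.

End euclidean_topology.

Section row_measurability.
Context {R : realType} {d : nat}.
Implicit Types (x : 'rV[R]_d) (U : set 'rV[R]_d) (r : R).

(** The sigma-algebra is generated by the coordinates, so [U] is written as the countable union of
    the rational cubes [B p] that it contains, enumerated by [pickle]. *)
Lemma open_row_measurable U : open U -> measurable U.
Proof.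
move=> oU.
pose B (p : nat * {ffun 'I_d -> rat}) : set 'rV[R]_d :=
  [set y | forall i, `|y ord0 i - ratr (p.2 i)| < p.1.+1%:R^-1].
have mB p : measurable (B p).
  rewrite (_ : B p = \bigcap_(i in [set: 'I_d])
      ((fun y : 'rV[R]_d => y ord0 i) @^-1` [set t | `|t - ratr (p.2 i)| < p.1.+1%:R^-1])).
    apply: fin_bigcap_measurable => // i _.
    rewrite -[X in measurable X]setTI; apply: measurable_row_coord => //.
    by have := @measurable_ball R (ratr (p.2 i)) p.1.+1%:R^-1;
      rewrite -ball_normE/=; under [X in measurable X]eq_set do rewrite distrC.
  by apply/seteqP; split => y yB i; [move=> _; exact: yB|exact: (yB i I)].
pose F k := if unpickle k is Some p then (if `[< B p `<=` U >] then B p else set0) else set0.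
rewrite (_ : U = \bigcup_k F k).
  by apply: bigcup_measurable => k _; rewrite /F; case: unpickle => // p; case: ifP.
apply/seteqP; split => [x Ux|x [k _]]; last first.
  by rewrite /F; case: unpickle => // p; case: ifPn => // /asboolP; exact.
have /nbhs_ballP[e /= e0 eU] := open_nbhs_nbhs (conj oU Ux).
(* Two points within [1 / (k + 1)] of the same rational centre have coordinates closer than
   [2 / (k + 1) < e]. *)
pose k := Num.truncn (2 / e).
have ke : 2 * k.+1%:R^-1 < e.
  by rewrite ltr_pdivrMr// mulrC -ltr_pdivrMr// truncnS_gt.
have k0 : 0 < k.+1%:R^-1 :> R by rewrite invr_gt0.
have /fin_all_exists[q qP] i : exists q : rat, `|x ord0 i - ratr q| < k.+1%:R^-1.
  have /rat_in_itvoo[q] : x ord0 i - k.+1%:R^-1 < x ord0 i + k.+1%:R^-1.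
    by rewrite ltrBlDr -addrA ltrDl addr_gt0.
  rewrite in_itv/= => /andP[h1 h2]; exists q.
  by rewrite ltr_distlC h1 h2.
exists (pickle (k, [ffun i => q i])) => //.
rewrite /F pickleK ifT; last first.
  apply/asboolP => y yB; apply: eU; split => // i j.
  rewrite (ord1 i) /ball/= (le_lt_trans _ ke)//.
  have := yB j; have := qP j; rewrite /= ffunE => h1 h2.
  rewrite (le_trans (ler_distD (ratr (q j)) _ _))// mulr_natl mulr2n.
  by rewrite lerD// ltW// distrC.
by move=> i; rewrite /= ffunE.
Qed.

Lemma measurable_eball x r : measurable (eball x r).
Proof. by apply: open_row_measurable; exact: open_eball. Qed.

Lemma continuous_row_measurable (f : 'rV[R]_d -> R) :
  continuous f -> measurable_fun setT f.
Proof.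
move=> /continuousP cf; apply: (measurability _ (RGenOpens.measurableE R)).
move=> _ [_ [a [b ->] <-]]; rewrite setTI.
by apply: open_row_measurable; apply: cf; exact: interval_open.
Qed.

Lemma measurable_enorm : measurable_fun [set: 'rV[R]_d] (@enorm R d).
Proof. by apply: continuous_row_measurable; exact: enorm_continuous. Qed.

Lemma measurable_rowD dT (T : measurableType dT) (f g : T -> 'rV[R]_d) :
  measurable_fun setT f -> measurable_fun setT g ->
  measurable_fun setT (fun t => f t + g t).
Proof.
move=> mf mg; apply: measurable_fun_row => i; under eq_fun do rewrite mxE.
by apply: measurable_funD; apply: (measurableT_comp (measurable_row_coord i)).
Qed.

Lemma measurable_rowZ dT (T : measurableType dT) (k : T -> R) (f : T -> 'rV[R]_d) :
  measurable_fun setT k -> measurable_fun setT f ->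
  measurable_fun setT (fun t => k t *: f t).
Proof.
move=> mk mf; apply: measurable_fun_row => i; under eq_fun do rewrite mxE.
by apply: measurable_funM => //; apply: (measurableT_comp (measurable_row_coord i)).
Qed.

Lemma measurable_normalize : measurable_fun setT (@normalize R d).
Proof.
apply: measurable_rowZ; last exact: measurable_id.
rewrite (_ : (fun x => _) = (fun x : 'rV[R]_d => enorm x `^ (-1))).
  exact: (measurableT_comp (measurable_powR (-1)) measurable_enorm).
by apply/funext => x; rewrite powR_inv1// enorm_ge0.
Qed.

End row_measurability.

(** * Lebesgue measure of affine images and balls *)

Section lebesgue_affine.
Context {R : realType}.
Local Open Scope ereal_scope.

(** Uniqueness of Lebesgue measure: [t] times its image under [f] gives every half-open interval its
    length. *)
Lemma lebesgue_measure_affine (t v : R) (A : set R) : (0 < t)%R -> measurable A ->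
  lebesgue_measure ((fun x => t * x + v)%R @^-1` A) = (t^-1)%:E * lebesgue_measure A.
Proof.
move=> t0 mA; pose f (x : measurableTypeR R) : measurableTypeR R := (t * x + v)%R.
have mf : measurable_fun [set: measurableTypeR R] f.
  by apply: measurable_funD => //; exact: measurable_funM.
pose m : {measure set (measurableTypeR R) -> \bar R} :=
  mscale (NngNum (ltW t0))
    (measure_function_pushforward__canonical__measure_function_Measure
      (@lebesgue_measure R) mf).
suff -> : lebesgue_measure A = t%:E * lebesgue_measure (f @^-1` A).
  by rewrite muleA -EFinM mulVf ?mul1e// gt_eqF.
rewrite (@lebesgue_measure_unique R m)// => _ [[a b]/= ab <-].
rewrite /m/= /mscale/= /pushforward/=.
rewrite (_ : _ @^-1` _ = `]((a - v) / t)%R, ((b - v) / t)%R]%classic); last first.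
  apply/seteqP; split => x; rewrite /f/= !in_itv/= ltr_pdivrMr// ler_pdivlMr//.
    by rewrite ltrBlDr lerBrDr mulrC.
  by rewrite ltrBlDr lerBrDr mulrC.
rewrite !lebesgue_measure_itv/= !lte_fin ltr_pM2r ?invr_gt0// ltrD2r.
case: ifPn => _; last by rewrite mule0.
by rewrite -!EFinB -EFinM; congr _%:E; field; rewrite gt_eqF.
Qed.

(** Induction on the dimension: [t ^ (n + 1)] times the image measure agrees with the product
    measure on rectangles, by the one-dimensional case and the induction hypothesis, hence
    everywhere. *)
Lemma lebesgue_row_affine n (t : R) (v : 'rV[R]_n) (A : set 'rV[R]_n) :
  (0 < t)%R -> measurable A ->
  lebesgue_row n ((fun x => t *: x + v)%R @^-1` A) = (t^-1 ^+ n)%:E * lebesgue_row n A.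
Proof.
move=> t0; elim: n v A => [|n ih] v A mA.
  rewrite expr0 mul1e; congr (_ _); apply/seteqP.
  by split => x; rewrite /= (_ : (t *: x + v)%R = x)//; apply/rowP => -[].
have [v0 [w vE]] : exists v0 w, v = cons_row (v0, w).
  by exists (uncons_row v).1, (uncons_row v).2; apply/rowP => i;
    have [j ->|->] := unliftP ord0 i; rewrite ?cons_rowS ?cons_row0//= mxE.
pose T (p : measurableTypeR R * 'rV[R]_n) : measurableTypeR R * 'rV[R]_n :=
  ((t * p.1 + v0)%R, (t *: p.2 + w)%R).
have TE p : cons_row (T p) = (t *: cons_row p + v)%R.
  apply/rowP => i; rewrite vE [RHS]mxE [X in _ = (X + _)%R]mxE.
  by have [j ->|->] := unliftP ord0 i; rewrite ?cons_rowS ?cons_row0//= !mxE.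
have mT : measurable_fun [set: measurableTypeR R * 'rV[R]_n] T.
  apply: measurable_fun_pair.
    by apply: measurable_funD => //; apply: measurable_funM => //; exact: measurable_fst.
  by apply: measurable_rowD => //; apply: measurable_rowZ => //; exact: measurable_snd.
pose L := (@lebesgue_measure R \x lebesgue_row n).
have tn0 : (0 < t ^+ n.+1)%R by rewrite exprn_gt0.
pose m : {measure set (measurableTypeR R * 'rV[R]_n) -> \bar R} :=
  mscale (NngNum (ltW tn0))
    (measure_function_pushforward__canonical__measure_function_Measure L mT).
have mX : measurable (@cons_row R n @^-1` A).
  by rewrite -[X in measurable X]setTI; exact: measurable_cons_row.
have : L (@cons_row R n @^-1` A) = m (@cons_row R n @^-1` A).
  apply: (@product_measure_unique _ _ _ _ R lebesgue_measure (lebesgue_row n) m) => // B C mB mC.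
  rewrite /m/= /mscale/= /pushforward/=.
  rewrite (_ : T @^-1` _ = ((fun x => t * x + v0)%R @^-1` B) `*` ((fun x => t *: x + w)%R @^-1` C))//.
  rewrite product_measure1E//; last 2 first.
    by rewrite -[X in measurable X]setTI; apply: measurable_funD => //; exact: measurable_funM.
    rewrite -[X in measurable X]setTI; apply: measurable_rowD => //.
    by apply: measurable_rowZ => //; exact: measurable_id.
  rewrite [X in _ * (X * _)](lebesgue_measure_affine v0 t0 mB) ih// muleACA -EFinM [LHS]muleA -EFinM.
  by rewrite -exprS -exprMn mulfV ?expr1n ?mul1e// gt_eqF.
rewrite /m/= /mscale/= /pushforward/= => LE.
transitivity ((t^-1 ^+ n.+1)%:E * L (@cons_row R n @^-1` A)); last by [].
rewrite LE muleA -EFinM exprVn mulVf ?mul1e ?gt_eqF//.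
rewrite /= /lebesgue_step /pushforward; congr (_ _).
by apply/seteqP; split => p; rewrite /= TE.
Qed.

Lemma measurable_box n (a b : R) :
  measurable [set x : 'rV[R]_n | forall i, (a <= x ord0 i <= b)%R].
Proof.
rewrite (_ : [set x | _] = \bigcap_(i in [set: 'I_n])
    ((fun y : 'rV[R]_n => y ord0 i) @^-1` `[a, b]%classic)).
  apply: fin_bigcap_measurable => // i _.
  by rewrite -[X in measurable X]setTI; exact: measurable_row_coord.
apply/seteqP; split => y yB i; first by move=> _; rewrite /= in_itv/= yB.
by have := yB i I; rewrite /= in_itv.
Qed.

Lemma lebesgue_row_box n (a b : R) : (a <= b)%R ->
  lebesgue_row n [set x : 'rV[R]_n | forall i, (a <= x ord0 i <= b)%R] =
  ((b - a) ^+ n)%:E.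
Proof.
move=> ab; elim: n => [|n ih].
  by rewrite expr0 /= diracE mem_set// => -[].
rewrite /= /lebesgue_step /pushforward.
rewrite (_ : _ @^-1` _ = `[a, b]%classic `*` [set x : 'rV[R]_n | forall i, (a <= x ord0 i <= b)%R]).
  rewrite product_measure1E//; last exact: measurable_box.
  have h : @lebesgue_measure R `[a, b]%classic = (b - a)%:E.
    rewrite lebesgue_measure_itv/= lte_fin.
    by move: ab; rewrite le_eqVlt => /predU1P[->|->//]; rewrite ltxx subrr.
  by rewrite ih exprS EFinM; congr (_ * _).
apply/seteqP; split => [[x y] h|[x y] [/= h1 h2] i].
  split; first by have := h ord0; rewrite /= cons_row0 in_itv.
  by move=> i; have := h (lift ord0 i); rewrite /= cons_rowS.
have [j ->|->] := unliftP ord0 i; rewrite ?cons_rowS ?cons_row0 ?h2//=.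
Qed.

End lebesgue_affine.

Section ball_volume.
Context {R : realType}.
Local Open Scope ereal_scope.

Lemma lebesgue_row_eball n (x : 'rV[R]_n) (r : R) : (0 < r)%R ->
  lebesgue_row n (eball x r) = (r ^+ n)%:E * lebesgue_row n (@unit_ball R n).
Proof.
move=> r0; have -> : @unit_ball R n = (fun y => r *: y + x)%R @^-1` eball x r.
  apply/seteqP; split => y; rewrite /unit_ball /eball/= subr0 addrK enormZ gtr0_norm//.
    by move=> y1; rewrite gtr_pMr.
  by rewrite gtr_pMr.
rewrite lebesgue_row_affine//; last exact: measurable_eball.
by rewrite muleA -EFinM -exprMn mulfV ?expr1n ?mul1e// gt_eqF.
Qed.

Lemma lebesgue_row_unit_ball_lty n : lebesgue_row n (@unit_ball R n) < +oo.
Proof.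
apply: (@le_lt_trans _ _ (lebesgue_row n [set x : 'rV[R]_n | forall i, (-1 <= x ord0 i <= 1)%R])).
  rewrite le_measure ?inE//; [exact: measurable_eball|exact: measurable_box|].
  move=> x; rewrite /unit_ball /eball/= subr0 => x1 i.
  by rewrite -ler_norml (le_trans (ler_coord_enorm x i))// ltW.
by rewrite lebesgue_row_box ?ltry//; lra.
Qed.

Lemma lebesgue_row_unit_ball_gt0 n : 0 < lebesgue_row n (@unit_ball R n).
Proof.
(* A cube of side [1 / (n + 1)] fits into the ball: as [a <= 1], the sum of the squares is at most
   [n a < 1]. *)
pose a : R := (n.+1%:R^-1)%R; have a0 : (0 < a)%R by rewrite invr_gt0.
apply: (@lt_le_trans _ _ (lebesgue_row n [set x : 'rV[R]_n | forall i, (0 <= x ord0 i <= a)%R])).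
  by rewrite lebesgue_row_box ?ltW// subr0 lte_fin exprn_gt0.
rewrite le_measure ?inE//; [exact: measurable_box|exact: measurable_eball|].
move=> x xa; rewrite /unit_ball /eball/= subr0.
have a1 : (a <= 1)%R by rewrite invf_le1// ler1n.
rewrite -(@ltr_pXn2r _ 2)// ?nnegrE ?enorm_ge0// expr1n sqr_enorm.
apply: (@le_lt_trans _ _ (\sum_(i < n) a)%R); last first.
  by rewrite sumr_const card_ord -mulr_natl ltr_pdivrMr// mul1r ltr_nat.
apply: ler_sum => i _; have /andP[x0 xa'] := xa i.
by rewrite -[leRHS]mul1r ler_pM// (le_trans xa').
Qed.

Definition ball_volume n : R := fine (lebesgue_row n (@unit_ball R n)).

Lemma ball_volumeE n : lebesgue_row n (@unit_ball R n) = (ball_volume n)%:E.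
Proof. by rewrite fineK// ge0_fin_numE// lebesgue_row_unit_ball_lty. Qed.

Lemma ball_volume_gt0 n : (0 < ball_volume n)%R.
Proof. by rewrite -lte_fin -ball_volumeE lebesgue_row_unit_ball_gt0. Qed.

End ball_volume.

(** * Uniformly distributed measures *)

Section uniform_measures.
Context {R : realType} {d : nat}.
Local Open Scope ereal_scope.
Implicit Types (x y : 'rV[R]_d) (U S : set 'rV[R]_d) (r : R).

(** Erosion of [U]: around its points a ball of radius [r] is not cut off by [U], so the double
    integral sees full balls. *)
Definition inner U r : set 'rV[R]_d := [set x | eball x r `<=` U].

Lemma measurable_inner U r : measurable (inner U r).
Proof.
rewrite -[inner U r]setCK; apply: measurableC; apply: open_row_measurable.
rewrite (_ : ~` _ = \bigcup_(y in ~` U) eball y r).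
  by apply: bigcup_open => y _; exact: open_eball.
apply/seteqP; split => x /=.
  by rewrite /inner/= => /existsNP[y /not_implyP[xy Uy]]; exists y => //; exact/eballC.
by move=> [y Uy /eballC xy] xU; apply: Uy; exact: xU.
Qed.

Lemma measurable_near r : measurable [set p : 'rV[R]_d * 'rV[R]_d | (enorm (p.1 - p.2) < r)%R].
Proof.
have mf : measurable_fun setT (fun p : 'rV[R]_d * 'rV[R]_d => enorm (p.1 - p.2)).
  apply: (measurableT_comp measurable_enorm); apply: measurable_rowD.
    exact: measurable_fst.
  under eq_fun do rewrite -scaleN1r.
  by apply: measurable_rowZ => //; exact: measurable_snd.
rewrite (_ : [set _ | _] = (fun p : 'rV[R]_d * 'rV[R]_d => enorm (p.1 - p.2)) @^-1` `]-oo, r[).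
  by rewrite -[X in measurable X]setTI; exact: mf.
by apply/seteqP; split => p /=; rewrite in_itv.
Qed.

Section fubini.
Variables (m1 m2 : {sigma_finite_measure set 'rV[R]_d -> \bar R}).

(* Integrate the indicator of [|x - y| < r] over [inner U r `*` U] in both
   orders. *)
Lemma uniform_measures_fubini S U r g h : measurable S -> measurable U -> 0 <= g ->
  (forall x, S x -> m1 (eball x r `&` S) = g) ->
  (forall x, S x -> m2 (eball x r `&` S) = h) ->
  h * m1 (inner U r `&` S) <= g * m2 (U `&` S).
Proof.
move=> mS mU g0 m1g m2h.
pose E : set ('rV[R]_d * 'rV[R]_d) :=
  ((inner U r `&` S) `*` S) `&` [set p | (enorm (p.1 - p.2) < r)%R].
have mA : measurable (inner U r `&` S).
  by apply: measurableI => //; exact: measurable_inner.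
have mE : measurable E by apply: measurableI; [exact: measurableX|exact: measurable_near].
have mUS : measurable (U `&` S) by exact: measurableI.
have m12 : (m1 \x m2) E = (m1 \x^ m2) E.
  by apply: product_measure_unique => // A B mA' mB'; exact: product_measure2E.
have <- : (m1 \x m2) E = h * m1 (inner U r `&` S).
  rewrite -integral_cst// integral_mkcond; apply: eq_integral => x _.
  rewrite /= patchE; case: ifPn => [/set_mem[Ux Sx]|xA].
    rewrite -(m2h x Sx); congr (m2 _); apply/seteqP; split => y; rewrite /xsection/= inE.
      by move=> [[_ Sy]/= /eballC xy]; split => //; exact/eballC.
    by move=> [/eballC xy Sy]; split.
  rewrite (_ : xsection E x = set0) ?measure0//.
  rewrite -subset0 => y; rewrite /xsection/= inE => -[[/mem_set]]/=.
  by rewrite (negbTE xA).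
rewrite m12 -integral_cst// [leRHS]integral_mkcond; apply: ge0_le_integral => //.
- exact: measurable_fun_ysection.
- by apply/(measurable_restrictT _ _).1.
- move=> y _; rewrite /= patchE; case: ifPn => [/set_mem[Uy Sy]|yA].
    rewrite -(m1g y Sy); apply: le_measure; rewrite ?inE.
    + exact: measurable_ysection.
    + by apply: measurableI => //; exact: measurable_eball.
    + by move=> x; rewrite /ysection/= inE => -[[[_ Sx] _]].
  rewrite (_ : ysection E y = set0) ?measure0//.
  rewrite -subset0 => x; rewrite /ysection/= inE => -[[[xU Sx] Sy]/= xy].
  move/negP: yA; apply; apply/mem_set; split => //; apply: xU.
  exact/eballC.
Qed.

End fubini.

(** Removes the erosion from the Fubini inequality: openness makes the erosions exhaust [U], and the
    measure is continuous from below. *)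
Lemma cvg_inner (m : {measure set 'rV[R]_d -> \bar R}) S U : measurable S -> open U ->
  m (inner U n.+1%:R^-1 `&` S) @[n --> \oo] --> m (U `&` S).
Proof.
move=> mS oU; have mI n : measurable (inner U n.+1%:R^-1 `&` S).
  by apply: measurableI => //; exact: measurable_inner.
rewrite (_ : U `&` S = \bigcup_n (inner U n.+1%:R^-1 `&` S)).
  apply: nondecreasing_cvg_mu => //; first exact: bigcup_measurable.
  move=> i j ij; apply/subsetPset => x [xU Sx]; split => // y xy; apply: xU.
  by rewrite /eball/= (lt_le_trans xy)// lef_pV2 ?posrE// ler_nat.
apply/seteqP; split => [x [Ux Sx]|x [n _ [xU Sx]]]; last first.
  by split => //; apply: xU; apply: eball_center; rewrite invr_gt0.
have [e e0 eU] := (open_eballP U).1 oU x Ux.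
exists (Num.truncn e^-1) => //; split => // y xy; apply: eU.
by rewrite /eball/= (lt_le_trans xy)// invf_ple ?posrE// ltW// truncnS_gt.
Qed.

Lemma uniform_measures_le (m1 m2 : {sigma_finite_measure set 'rV[R]_d -> \bar R})
    (h : R -> R) : (forall r, 0 < r -> 0 < h r)%R ->
  (forall x r, (0 < r)%R -> m1 (eball x r) = (h r)%:E) ->
  (forall x r, (0 < r)%R -> m2 (eball x r) = (h r)%:E) ->
  forall U, open U -> m1 U <= m2 U.
Proof.
move=> h0 m1h m2h U oU.
have := @cvg_inner m1 setT U measurableT oU; rewrite setIT => cU.
apply: (cvge_to_le cU); apply: nearW => n; rewrite setIT.
have r0 : (0 < n.+1%:R^-1 :> R)%R by rewrite invr_gt0.
have hr := h0 _ r0.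
have := @uniform_measures_fubini m1 m2 setT U n.+1%:R^-1 (h n.+1%:R^-1)%:E (h n.+1%:R^-1)%:E measurableT (open_row_measurable oU).
rewrite !setIT lee_fin ltW// lee_pmul2l//; apply => // x _; rewrite setIT.
  exact: m1h.
exact: m2h.
Qed.

(* The same identity for the whole space fixes the ratio of the ball measures. *)
Lemma uniform_measures_balance
    (m1 m2 : {finite_measure set 'rV[R]_d -> \bar R}) (g h a b r : R) S :
  measurable S -> (0 <= g)%R -> (0 <= h)%R -> m1 S = a%:E -> m2 S = b%:E ->
  (forall x, S x -> m1 (eball x r `&` S) = g%:E) ->
  (forall x, S x -> m2 (eball x r `&` S) = h%:E) ->
  (h * a = g * b)%R.
Proof.
move=> mS g0 h0 m1S m2S m1g m2h.
have innerT : inner setT r = setT by apply/seteqP; split.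
have := @uniform_measures_fubini m1 m2 S setT r g%:E h%:E mS measurableT g0 m1g m2h.
have := @uniform_measures_fubini m2 m1 S setT r h%:E g%:E mS measurableT h0 m2h m1g.
rewrite innerT !setTI => h1 h2.
have {}h1 : g%:E * m2 S <= h%:E * m1 S by [].
have {}h2 : h%:E * m1 S <= g%:E * m2 S by [].
move: h1 h2; rewrite m1S m2S -!EFinM !lee_fin => h1 h2.
by apply/eqP; rewrite eq_le h1 h2.
Qed.

(** The balance of total masses gives [g r = h r * (a / b)] for each [r], so the positive factor
    [h r] cancels from the Fubini inequality before [r] tends to 0. *)
Lemma uniform_measures_proportional_le
    (m1 m2 : {finite_measure set 'rV[R]_d -> \bar R}) (g h : R -> R) (a b : R) S :
  measurable S -> (0 < b)%R -> m1 S = a%:E -> m2 S = b%:E ->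
  (forall r, 0 < r -> 0 <= g r)%R -> (forall r, 0 < r -> 0 < h r)%R ->
  (forall x r, (0 < r)%R -> S x -> m1 (eball x r `&` S) = (g r)%:E) ->
  (forall x r, (0 < r)%R -> S x -> m2 (eball x r `&` S) = (h r)%:E) ->
  forall U, open U -> m1 (U `&` S) <= (a / b)%:E * m2 (U `&` S).
Proof.
move=> mS b0 m1S m2S g0 h0 m1g m2h U oU.
have cU : m1 (inner U n.+1%:R^-1 `&` S) @[n --> \oo] --> m1 (U `&` S).
  exact: cvg_inner.
apply: (cvge_to_le cU); apply: nearW => n.
have r0 : (0 < n.+1%:R^-1 :> R)%R by rewrite invr_gt0.
move: (n.+1%:R^-1)%R r0 => r r0; have hr := h0 _ r0; have gr := g0 _ r0.
have m1r x := m1g x r r0; have m2r x := m2h x r r0.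
have E := uniform_measures_balance mS gr (ltW hr) m1S m2S m1r m2r.
have := @uniform_measures_fubini m1 m2 S U r (g r)%:E (h r)%:E mS (open_row_measurable oU) gr m1r m2r.
have -> : g r = (h r * (a / b))%R.
  by rewrite mulrA E mulfK// gt_eqF.
by rewrite EFinM -muleA lee_pmul2l.
Qed.

Lemma uniform_measures_proportional
    (m1 m2 : {finite_measure set 'rV[R]_d -> \bar R}) (g h : R -> R) (a b : R) S :
  measurable S -> (0 < a)%R -> (0 < b)%R -> m1 S = a%:E -> m2 S = b%:E ->
  (forall r, 0 < r -> 0 < h r)%R ->
  (forall x r, (0 < r)%R -> S x -> m1 (eball x r `&` S) = (g r)%:E) ->
  (forall x r, (0 < r)%R -> S x -> m2 (eball x r `&` S) = (h r)%:E) ->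
  S !=set0 ->
  forall U, open U -> m1 (U `&` S) = (a / b)%:E * m2 (U `&` S).
Proof.
move=> mS a0 b0 m1S m2S h0 m1g m2h [x0 Sx0] U oU.
(* Exchanging the two measures requires [g] to be positive as well; this follows from the balance,
   because [h r * a > 0]. *)
have g0 r : (0 < r -> 0 < g r)%R.
  move=> r0; have g0 : (0 <= g r)%R by rewrite -lee_fin -(m1g x0).
  have m1r x := m1g x r r0; have m2r x := m2h x r r0.
  have E := uniform_measures_balance mS g0 (ltW (h0 _ r0)) m1S m2S m1r m2r.
  rewrite lt0r g0 andbT; apply/eqP => gr0; move: E; rewrite gr0 mul0r => /eqP.
  by rewrite mulf_eq0 !gt_eqF// h0.
apply/eqP; rewrite eq_le; apply/andP; split.
  apply: (uniform_measures_proportional_le (g := g) (h := h)) => //.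
  by move=> r r0; rewrite ltW// g0.
have ab0 : (0 < a / b)%R by rewrite divr_gt0.
rewrite muleC -lee_pdivlMr// muleC invf_div.
apply: (uniform_measures_proportional_le (g := h) (h := g)) => //.
by move=> r r0; rewrite ltW// h0.
Qed.

End uniform_measures.

(** * Isometry invariance of Lebesgue measure, and reflections *)

Section isometries.
Context {R : realType} {d : nat}.
Local Open Scope ereal_scope.
Variable T : 'rV[R]_d -> 'rV[R]_d.
Hypotheses (T_isometry : forall x y, enorm (T x - T y) = enorm (x - y))
  (TK : involutive T).

Lemma measurable_isometry : measurable_fun setT T.
Proof.
apply: measurable_fun_row => i; apply: continuous_row_measurable.
apply: lipschitz1_continuous => x y; rewrite -T_isometry.
by have := ler_coord_enorm (T x - T y) i; rewrite !mxE.
Qed.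

Lemma preimage_isometry_eball x r : T @^-1` eball x r = eball (T x) r.
Proof.
apply/seteqP; split => y; rewrite /eball/= -(T_isometry y) TK//.
Qed.

Lemma open_preimage_isometry U : open U -> open (T @^-1` U).
Proof.
move=> /open_eballP oU; apply/open_eballP => x /= /oU[e e0 eU]; exists e => //.
by move=> y xy; apply: eU; rewrite /eball/= T_isometry.
Qed.

(** The image measure is equipped with a sigma-finite structure so that [uniform_measures_le]
    applies to it. *)
Let L := pushforward (lebesgue_row d) T.

Let L0 : L set0 = 0.
Proof. by rewrite /L /pushforward preimage_set0 measure0. Qed.

Let L_ge0 A : 0 <= L A. Proof. exact: (measure_ge0 (lebesgue_row d)). Qed.

Let L_sigma_additive : semi_sigma_additive L.
Proof.
exact: (@measure_semi_sigma_additive _ _ _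
  (measure_function_pushforward__canonical__measure_function_Measure (lebesgue_row d) measurable_isometry)).
Qed.

HB.instance Definition _ := isMeasure.Build _ _ _ L L0 L_ge0 L_sigma_additive.

Let L_sigma_finite : sigma_finite setT L.
Proof.
exists (fun k => eball 0%R k.+1%:R).
  apply/esym/seteqP; split => // x _; exists (Num.truncn (enorm x)) => //.
  by rewrite /eball/= subr0 truncnS_gt.
move=> k; split; first exact: measurable_eball.
change (lebesgue_row d (T @^-1` eball 0%R k.+1%:R) < +oo).
rewrite preimage_isometry_eball lebesgue_row_eball//.
by rewrite ball_volumeE -EFinM ltry.
Qed.

HB.instance Definition _ := Measure_isSigmaFinite.Build _ _ _ L L_sigma_finite.

(* Lebesgue measure and its image under [T] agree on balls, hence on open sets. *)
Lemma lebesgue_row_isometry U : open U ->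
  lebesgue_row d (T @^-1` U) = lebesgue_row d U.
Proof.
have le V : open V -> lebesgue_row d V <= lebesgue_row d (T @^-1` V).
  move=> oV; rewrite -[leRHS]/(L V).
  pose M : {sigma_finite_measure set 'rV[R]_d -> \bar R} := L.
  have h0 r : (0 < r -> 0 < r ^+ d * ball_volume d :> R)%R.
    by move=> r0; rewrite mulr_gt0 ?exprn_gt0 ?ball_volume_gt0.
  apply: (@uniform_measures_le R d (lebesgue_row d) M (fun r => r ^+ d * ball_volume d)%R h0) => // x r r0.
    by rewrite lebesgue_row_eball// ball_volumeE.
  by rewrite -[LHS]/(L _) /L /pushforward preimage_isometry_eball lebesgue_row_eball// ball_volumeE.
move=> oU; apply/eqP; rewrite eq_le le// andbT.
apply: (le_trans (le _ (open_preimage_isometry oU))).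
rewrite le_eqVlt; apply/orP; left; apply/eqP; congr (_ _).
by apply/seteqP; split => x; rewrite /= TK.
Qed.

End isometries.

Section reflections.
Context {R : realType} {d : nat}.
Implicit Types x y n : 'rV[R]_d.

(* The identity when [n = 0], since then [2 * dot x n / 0 = 0]. *)
Definition reflection n x : 'rV[R]_d := x - (2 * dot x n / dot n n) *: n.

Lemma reflectionZ n a x : reflection n (a *: x) = a *: reflection n x.
Proof.
by rewrite /reflection dotZl scalerBr scalerA; congr (_ - _ *: _); ring.
Qed.

Lemma reflectionB n x y : reflection n x - reflection n y = reflection n (x - y).
Proof.
rewrite /reflection dotDl dotNl mulrBr mulrBl scalerBl.
by rewrite !opprD !opprK addrACA.
Qed.

Lemma enorm_reflection n x : enorm (reflection n x) = enorm x.
Proof.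
rewrite /enorm; congr Num.sqrt; rewrite /reflection.
rewrite dotDl !dotDr !dotNl !dotNr !dotZl !dotZr (dotC n x).
have [->|n0] := eqVneq n 0; first by rewrite (dotC x) !dot0l; ring.
have nn0 : dot n n != 0 by rewrite -sqr_enorm expf_neq0// enorm_eq0.
by move: (dot x n) (dot n n) nn0 => u v v0; field.
Qed.

Lemma reflectionK n : involutive (reflection n).
Proof.
move=> x; rewrite {1}/reflection.
have [->|n0] := eqVneq n 0; first by rewrite /reflection !scaler0 !subr0.
have nn0 : dot n n != 0 by rewrite -sqr_enorm expf_neq0// enorm_eq0.
rewrite [dot (reflection n x) n](_ : _ = - dot x n).
  by rewrite /reflection mulrN mulNr scaleNr opprK subrK.
by rewrite /reflection dotDl dotNl dotZl mulfVK//; ring.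
Qed.

Lemma reflection_isometry n x y :
  enorm (reflection n x - reflection n y) = enorm (x - y).
Proof. by rewrite reflectionB enorm_reflection. Qed.

(** For equal norms [2 x.(x - y) = |x - y|^2], so the coefficient in the reflection is 1.
    Reflections therefore act transitively on the sphere. *)
Lemma reflection_swap x y : enorm x = enorm y -> reflection (x - y) x = y.
Proof.
move=> xy; have [->|n0] := eqVneq x y.
  by rewrite /reflection subrr scaler0 subr0.
rewrite -subr_eq0 in n0.
have nn0 : dot (x - y) (x - y) != 0 by rewrite -sqr_enorm expf_neq0// enorm_eq0.
rewrite /reflection (_ : _ / _ = 1) ?scale1r ?subKr//.
have E : 2 * dot x (x - y) = dot (x - y) (x - y).
  have := congr1 (fun t => t ^+ 2) xy; rewrite !sqr_enorm => xxyy.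
  by rewrite dotDl !dotDr !dotNl !dotNr (dotC y x); lra.
by rewrite E divff.
Qed.

End reflections.

(** * Hausdorff measure *)

Section hausdorff_basics.
Context {R : realType}.
Local Open Scope ereal_scope.

Lemma diam_leP n (A : set 'rV[R]_n) (r : R) :
  diam A <= r%:E <-> forall x y, A x -> A y -> (enorm (x - y) <= r)%R.
Proof.
split=> [Ar x y Ax Ay|Ar].
  rewrite -lee_fin (le_trans _ Ar)//; apply: ereal_sup_ubound.
  by exists x => //; exists y.
by apply: ge_ereal_sup => _ [x Ax [y Ay <-]]; rewrite lee_fin Ar.
Qed.

Lemma hausdorff_gaugeE n s (A : set 'rV[R]_n) (delta : R) : A !=set0 ->
  diam A <= delta%:E ->
  hausdorff_gauge s A = (ball_volume s * (fine (diam A) / 2) ^+ s)%:E.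
Proof.
move=> A0 Ad; rewrite /hausdorff_gauge ifF; last by apply/negbTE/set0P.
have : diam A \is a fin_num.
  by rewrite ge0_fin_numE ?diam_ge0// (le_lt_trans Ad) ?ltry.
case: (diam A) => [r| |]// _.
by rewrite ball_volumeE -EFinM -EFin_expe -EFinM.
Qed.

Lemma hausdorff_gauge_le n s (A : set 'rV[R]_n) (r : R) :
  (0 <= r)%R -> diam A <= r%:E ->
  hausdorff_gauge s A <= (ball_volume s * (r / 2) ^+ s)%:E.
Proof.
move=> r0 Ar; have b0 := ltW (@ball_volume_gt0 R s).
have [->|/set0P A0] := eqVneq A set0.
  by rewrite /hausdorff_gauge eqxx lee_fin mulr_ge0// exprn_ge0// divr_ge0.
rewrite (hausdorff_gaugeE s A0 Ar) lee_fin ler_wpM2l//.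
have d0 : (0 <= fine (diam A))%R by rewrite fine_ge0// diam_ge0.
rewrite lerXn2r ?nnegrE ?divr_ge0// ler_wpM2r//.
by rewrite -lee_fin fineK// ge0_fin_numE ?diam_ge0// (le_lt_trans Ar) ?ltry.
Qed.

Lemma le_hausdorff_gauge n s (A B : set 'rV[R]_n) (delta : R) : A `<=` B ->
  diam B <= delta%:E -> hausdorff_gauge s A <= hausdorff_gauge s B.
Proof.
move=> AB Bd; have [->|/set0P[x Ax]] := eqVneq A set0.
  by rewrite {1}/hausdorff_gauge eqxx hausdorff_gauge_ge0.
have B0 : B !=set0 by exists x; exact: AB.
rewrite (hausdorff_gaugeE s B0 Bd).
have Bfin : diam B \is a fin_num.
  by rewrite ge0_fin_numE ?diam_ge0// (le_lt_trans Bd) ?ltry.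
apply: hausdorff_gauge_le; first by rewrite fine_ge0// diam_ge0.
apply/diam_leP => y z Ay Az; have /diam_leP : diam B <= (fine (diam B))%:E.
  by rewrite fineK.
by apply; exact: AB.
Qed.

Lemma le_hausdorff_pre n s (A : set 'rV[R]_n) (d1 d2 : R) : (d1 <= d2)%R ->
  hausdorff_pre s d2 A <= hausdorff_pre s d1 A.
Proof.
move=> d12; apply: le_ereal_inf => _ [F [AF dF] <-]; exists F => //.
by split => // k; rewrite (le_trans (dF k))// lee_fin.
Qed.

Lemma hausdorff_pre_ge0 n s (A : set 'rV[R]_n) delta : 0 <= hausdorff_pre s delta A.
Proof.
apply: le_ereal_inf_tmp => _ [F _ <-]; apply: nneseries_ge0 => k _ _.
exact: hausdorff_gauge_ge0.
Qed.

Lemma hausdorff_pre_le n s (A : set 'rV[R]_n) delta : (0 < delta)%R ->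
  hausdorff_pre s delta A <= hausdorff s A.
Proof. by move=> delta0; apply: ereal_sup_ubound; exists delta. Qed.

(** A cover of [A] by sets of diameter at most [delta / L] is carried to a cover of the image by
    sets of diameter at most [delta], and each gauge grows by a factor of at most [L ^ s]. The
    covering sets are first cut down to [A], where [f] is controlled. *)
Lemma hausdorff_lipschitz m n s (A : set 'rV[R]_m) (f : 'rV[R]_m -> 'rV[R]_n) (L : R) :
  (0 < L)%R ->
  (forall x y, A x -> A y -> enorm (f x - f y) <= L * enorm (x - y))%R ->
  hausdorff s (f @` A) <= (L ^+ s)%:E * hausdorff s A.
Proof.
move=> L0 fL; apply: ge_ereal_sup => _ [delta /= delta0 <-].
have dL0 : (0 < delta / L)%R by rewrite divr_gt0.
apply: (@le_trans _ _ ((L ^+ s)%:E * hausdorff_pre s (delta / L) A)); last first.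
  by rewrite lee_pmul2l ?lte_fin ?exprn_gt0// hausdorff_pre_le.
rewrite -lee_pdivrMl ?exprn_gt0//.
apply: le_ereal_inf_tmp => _ [F [AF dF] <-].
rewrite lee_pdivrMl ?exprn_gt0// -nneseriesZl//; last first.
  by move=> k _; exact: hausdorff_gauge_ge0.
pose G k := f @` (F k `&` A).
have dG k : diam (G k) <= (L * fine (diam (F k)))%:E.
  apply/diam_leP => _ _ [x [Fx Ax] <-] [y [Fy Ay] <-].
  rewrite (le_trans (fL _ _ Ax Ay))// ler_wpM2l ?(ltW L0)//.
  have F0 : F k !=set0 by exists x.
  have Ffin : diam (F k) \is a fin_num.
    by rewrite ge0_fin_numE ?diam_ge0// (le_lt_trans (dF k)) ?ltry.
  by have /diam_leP : diam (F k) <= (fine (diam (F k)))%:E; [rewrite fineK|exact].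
have fd k : (fine (diam (F k)) <= delta / L)%R.
  have := dF k; case: (diam (F k)) => [r|//|_]/=; last exact: ltW.
  by rewrite lee_fin.
apply: (@le_trans _ _ (\sum_(k <oo) hausdorff_gauge s (G k))).
  apply: ereal_inf_lbound; exists G => //; split.
    move=> _ [x Ax <-]; have [k _ Fx] := AF x Ax; exists k => //; exists x => //.
  move=> k; rewrite (le_trans (dG k))// lee_fin.
  by rewrite mulrC -ler_pdivlMr.
apply: lee_nneseries => k _; first by move=> _; exact: hausdorff_gauge_ge0.
have [G0|/set0P G0] := eqVneq (G k) set0.
  by rewrite G0 {1}/hausdorff_gauge eqxx mule_ge0 ?hausdorff_gauge_ge0// lee_fin exprn_ge0// ltW.
have F0 : F k !=set0 by have [_ [x [Fx _] _]] := G0; exists x.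
rewrite (hausdorff_gaugeE s F0 (dF k)).
apply: le_trans (hausdorff_gauge_le s _ (dG k)) _.
  by rewrite mulr_ge0 ?fine_ge0 ?diam_ge0// ltW.
by rewrite -EFinM lee_fin mulrCA -mulrA exprMn le_eqVlt eqxx.
Qed.

(** A set of diameter less than [eta] cannot meet both [A] and [B], so a sufficiently fine cover of
    the union splits into covers of the two sets. *)
Lemma hausdorff_metric n s (A B : set 'rV[R]_n) (eta : R) : (0 < eta)%R ->
  (forall x y, A x -> B y -> eta <= enorm (x - y))%R ->
  hausdorff s A + hausdorff s B <= hausdorff s (A `|` B).
Proof.
move=> eta0 AB.
have pre_le d : (0 < d)%R ->
    hausdorff_pre s d A + hausdorff_pre s d B <= hausdorff s (A `|` B).
  (* Half of [eta] makes the diameters strictly smaller than the separation, which may be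
     attained. *)
  move=> d0; pose d' := Num.min d (eta / 2)%R.
  have d'0 : (0 < d')%R by rewrite lt_min d0 divr_gt0.
  apply: (@le_trans _ _ (hausdorff_pre s d' (A `|` B))); last exact: hausdorff_pre_le.
  apply: le_ereal_inf_tmp => _ [F [ABF dF] <-].
  have le_pre (C : set 'rV[R]_n) : C `<=` A `|` B ->
      hausdorff_pre s d C <= \sum_(k <oo) hausdorff_gauge s (F k `&` C).
    move=> CAB; apply: ereal_inf_lbound; exists (fun k => F k `&` C) => //; split.
      by move=> x Cx; have [k _ Fx] := ABF x (CAB x Cx); exists k.
    move=> k; apply/diam_leP => x y [Fx _] [Fy _].
    have /diam_leP h := dF k; rewrite (le_trans (h _ _ Fx Fy))//.
    by rewrite ge_min lexx.
  apply: (le_trans (leeD (le_pre A _) (le_pre B _))) => //.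
  rewrite -nneseriesD//; last 2 first.
  - by move=> k _ _; exact: hausdorff_gauge_ge0.
  - by move=> k _ _; exact: hausdorff_gauge_ge0.
  apply: lee_nneseries => k _; first by move=> _; rewrite adde_ge0// hausdorff_gauge_ge0.
  have gle C : hausdorff_gauge s (F k `&` C) <= hausdorff_gauge s (F k).
    by apply: le_hausdorff_gauge (dF k); exact: subIsetl.
  have g0 : hausdorff_gauge s (@set0 'rV[R]_n) = 0 by rewrite /hausdorff_gauge eqxx.
  have [->|/set0P[x [Fx Ax]]] := eqVneq (F k `&` A) set0; first by rewrite g0 add0e.
  rewrite [F k `&` B](_ : _ = set0) ?g0 ?adde0//.
  rewrite -subset0 => y [Fy By]; have := AB x y Ax By.
  have /diam_leP/(_ x y Fx Fy) := dF k; rewrite le_min => /andP[_ h] h'.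
  by move: (le_trans h' h); rewrite leNgt ltr_pdivrMr// ltr_pMr// ltr1n.
have [->|ABoo] := eqVneq (hausdorff s (A `|` B)) +oo; first exact: leey.
have ABfin : hausdorff s (A `|` B) \is a fin_num.
  by rewrite ge0_fin_numE ?hausdorff_ge0// ltey.
have fin (f : \bar R) : 0 <= f -> f <= hausdorff s (A `|` B) -> f \is a fin_num.
  by move=> f0 fAB; rewrite ge0_fin_numE// (le_lt_trans fAB)// ltey.
have Bfin : hausdorff s B \is a fin_num.
  by rewrite fin ?hausdorff_ge0//; apply: le_hausdorff; exact: subsetUr.
(* The two suprema are taken one after the other, with scales [d1] and [d2]; the smaller scale
   serves both. *)
rewrite -leeBrDr//; apply: ge_ereal_sup => _ [d1 /= d10 <-].
have Pfin : hausdorff_pre s d1 A \is a fin_num.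
  rewrite fin ?hausdorff_pre_ge0// (le_trans (hausdorff_pre_le s A d10))//.
  by apply: le_hausdorff; exact: subsetUl.
rewrite leeBrDr// addeC -leeBrDr//; apply: ge_ereal_sup => _ [d2 /= d20 <-].
rewrite leeBrDr// addeC; have d0 : (0 < Num.min d1 d2)%R by rewrite lt_min d10.
apply: le_trans (pre_le _ d0); apply: leeD; apply: le_hausdorff_pre.
  by rewrite ge_min lexx.
by rewrite ge_min lexx orbT.
Qed.

End hausdorff_basics.

(** * Borel sets are Caratheodory measurable for Hausdorff measure *)

Section hausdorff_measurability.
Context {R : realType} {n : nat}.
Local Open Scope ereal_scope.

(* With [Y k] the part of [X] where [phi >= 1 / (k + 1)] and [D k] the slice
   [1 / (k + 2) <= phi < 1 / (k + 1)], metric additivity gives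
   [H (Y k) + H (D (k + 1)) <= H (Y (k + 2))], so the slices are summable. *)
Lemma hausdorff_caratheodory_le0 s (phi : 'rV[R]_n -> R) :
  (forall x y, `|phi x - phi y| <= enorm (x - y))%R ->
  (hausdorff s).-caratheodory [set x | (phi x <= 0)%R].
Proof.
move=> phil; set C := [set x | _].
apply: le_caratheodory_measurable => X.
pose H : set 'rV[R]_n -> \bar R := hausdorff s.
change (H (X `&` C) + H (X `&` ~` C) <= H X).
have leH A B : A `<=` B -> H A <= H B by exact: le_hausdorff.
have H0 A : 0 <= H A by exact: hausdorff_ge0.
have [->|Xoo] := eqVneq (H X) +oo; first exact: leey.
have Xlt : H X < +oo by rewrite ltey.
have fin A : A `<=` X -> H A \is a fin_num.
  by move=> AX; rewrite ge0_fin_numE// (le_lt_trans (leH _ _ AX)).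
pose c k : R := (k.+1%:R^-1)%R.
have c0 k : (0 < c k)%R by rewrite invr_gt0.
have clt i j : (i < j)%N -> (c j < c i)%R.
  by move=> ij; rewrite ltf_pV2 ?posrE// ltr_nat.
have cle i j : (i <= j)%N -> (c j <= c i)%R.
  by move=> ij; rewrite lef_pV2 ?posrE// ler_nat.
pose Y k := X `&` [set x | (c k <= phi x)%R].
pose D k := X `&` [set x | (c k.+1 <= phi x < c k)%R].
have sep (A B : set 'rV[R]_n) (a b : R) : (a < b)%R ->
    (forall x, A x -> (phi x <= a)%R) -> (forall x, B x -> (b <= phi x)%R) ->
    H A + H B <= H (A `|` B).
  move=> ab Aa Bb; apply: (@hausdorff_metric _ _ s A B (b - a)%R).
    by rewrite subr_gt0.
  move=> x y Ax By; rewrite (le_trans _ (phil x y))// distrC.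
  by rewrite (le_trans _ (ler_norm _))// lerB ?Aa ?Bb.
have CY k : H (X `&` C) + H (Y k) <= H X.
  apply: (le_trans (sep _ _ 0%R (c k) (c0 k) _ _)).
  - by move=> x [].
  - by move=> x [].
  - by apply: leH => x [[]|[]].
have YD k : H (Y k) + H (D k.+1) <= H (Y k.+2).
  rewrite addeC; apply: (le_trans (sep _ _ _ _ (clt k k.+1 (leqnn _)) _ _)).
  - by move=> x [_ /= /andP[_ /ltW]].
  - by move=> x [].
  - apply: leH => x [[Xx /= /andP[h _]]|[Xx /= h]]; split => //=.
    by rewrite (le_trans _ h)// cle// -addn2 leq_addr.
(* Two consecutive sets [Y] appear because the slices of even and of odd index are absorbed in
   separate chains. *)
have sumD m : \sum_(0 <= j < m) H (D j.+1) <= H (Y m) + H (Y m.+1).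
  elim: m => [|m ih]; first by rewrite big_geq// adde_ge0.
  rewrite big_nat_recr//= (le_trans (leeD ih (lexx _)))//.
  by rewrite addeAC addeC leeD// YD.
have sumD_le : \sum_(0 <= j <oo) H (D j.+1) <= H X + H X.
  apply: lime_le; first by apply: is_cvg_nneseries => j _ _; exact: H0.
  apply: nearW => m; apply: (le_trans (sumD m)).
  by apply: leeD; apply: leH; exact: subIsetl.
have sumD_fin : \sum_(0 <= j <oo) H (D j) < +oo.
  rewrite (nneseries_split 0 1); last by move=> k _; exact: H0.
  rewrite add0n big_nat1 lte_add_pinfty//.
    by rewrite ltey_eq fin//; exact: subIsetl.
  rewrite -nneseries_addn; last by move=> k; exact: H0.
  apply: le_lt_trans; last first.
    apply: (le_lt_trans sumD_le); exact: lte_add_pinfty.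
  by under eq_eseriesr do rewrite addn1.
have tail := nneseries_tail_cvg sumD_fin (fun k _ => H0 (D k)).
have cover k : H (X `&` ~` C) <= H (Y k) + \sum_(k <= j <oo) H (D j).
  apply: (@le_trans _ _ (H (Y k `|` \bigcup_(j in ~` `I_k) D j))).
    apply: leH => x [Xx /negP]; rewrite -ltNge => x0.
    have [h|h] := leP (c k) (phi x); first by left.
    right; have ex : exists m, (c m.+1 <= phi x)%R.
      exists (Num.truncn (phi x)^-1).
      rewrite /c invf_ple ?posrE// ltW// (lt_le_trans (truncnS_gt _))//.
      by rewrite ler_nat.
    have [m hm mmin] := ex_minnP ex; exists m.
      move=> /= mk.
      by have := lt_le_trans (le_lt_trans hm h) (cle _ _ mk); rewrite ltxx.
    split => //=; rewrite hm/=; case: m hm mmin => [|m] hm mmin.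
      by rewrite (lt_le_trans h)// cle.
    by rewrite ltNge; apply/negP => /mmin; rewrite ltnn.
  apply: (le_trans (outer_measureU2 (hausdorff s) _ _)).
  by rewrite leeD2l// outer_measure_sigma_subadditive_tail.
have cv : H X + \sum_(k <= j <oo) H (D j) @[k --> \oo] --> H X + 0.
  by apply: cvgeD => //; [rewrite fin_num_adde_defr// fin|exact: cvg_cst].
rewrite adde0 in cv; apply: (cvge_to_ge cv); apply: nearW => k.
apply: (le_trans (leeD (lexx _) (cover k))).
by rewrite addeA leeD.
Qed.

(** Measurability of the identity says that Borel sets are Caratheodory measurable. Half-spaces
    generate the Borel sets, and each is the complement of a sublevel set of the 1-Lipschitz
    function [x_i - a]. *)
Lemma hausdorff_borel_measurable s :
  measurable_fun setT
    (idfun : caratheodory_type (hausdorff s : set 'rV[R]_n -> \bar R) -> 'rV[R]_n).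
Proof.
apply: measurable_fun_row => i; apply: (measurability _ (RGenOInfty.measurableE R)).
move=> _ [_ [a ->] <-]; rewrite setTI.
rewrite (_ : _ @^-1` _ = ~` [set x : 'rV[R]_n | (x ord0 i - a <= 0)%R]).
  apply: caratheodory_measurable_setC; apply: hausdorff_caratheodory_le0 => x y.
  rewrite opprB addrA subrK; have := ler_coord_enorm (x - y) i.
  by rewrite !mxE.
by apply/seteqP; split => x /=; rewrite in_itv/= andbT subr_le0 ltNge => /negP.
Qed.

(** The push-forward along the identity restricts [hausdorff s] to the Borel sets, where the lemmas
    on measures and integrals apply. *)
Definition hausdorff_measure s : {measure set 'rV[R]_n -> \bar R} :=
  let mu : {outer_measure set 'rV[R]_n -> \bar R} := hausdorff s in
  measure_function_pushforward__canonical__measure_function_Measure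
    (mu : set (caratheodory_type mu) -> \bar R) (@hausdorff_borel_measurable s).

Lemma hausdorff_measureE s A : hausdorff_measure s A = hausdorff s A.
Proof. by []. Qed.

End hausdorff_measurability.

(** * Finiteness and positivity of the measure of the sphere *)

Section hausdorff_finite_positive.
Context {R : realType}.
Local Open Scope ereal_scope.

(** Cover the box by [(N + 1)^s] cubes of side [1 / N], of diameter at most [sqrt s / N]. The factor
    [1 / 2] in the gauge absorbs [(N + 1) / N <= 2], so the bound does not depend on [N]. *)
Lemma hausdorff_unit_box_lty s :
  hausdorff s [set x : 'rV[R]_s | forall i, (0 <= x ord0 i <= 1)%R] < +oo.
Proof.
set Q := [set x | _].
suff : hausdorff s Q <= (ball_volume s * Num.sqrt s%:R ^+ s)%:E.
  by move=> /le_lt_trans; apply; rewrite ltry.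
apply: ge_ereal_sup => _ [delta /= delta0 <-].
have sq0 : (0 <= Num.sqrt s%:R :> R)%R by exact: sqrtr_ge0.
pose N := (Num.truncn (Num.sqrt s%:R / delta)).+1.
have N0 : (0 < N%:R :> R)%R by [].
have Nd : (Num.sqrt s%:R / N%:R <= delta)%R.
  by rewrite ler_pdivrMr// mulrC -ler_pdivrMr// ltW// truncnS_gt.
(* There are [N + 1] indices per axis because a coordinate equal to 1 has integer part [N] after
   scaling. *)
pose cube (j : {ffun 'I_s -> 'I_N.+1}) : set 'rV[R]_s :=
  [set y | forall i, ((j i)%:R <= N%:R * y ord0 i <= (j i)%:R + 1)%R].
have dcube j : diam (cube j) <= (Num.sqrt s%:R / N%:R)%:E.
  apply/diam_leP => y z yj zj; apply: enorm_le_coord; first by rewrite invr_ge0 ltW.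
  move=> i; rewrite !mxE -[leRHS]mul1r ler_pdivlMr// mulrC.
  rewrite -[X in (X * _)%R](ger0_norm (ltW N0)) -normrM mulrBr.
  have := yj i; have := zj i; rewrite ler_norml; lra.
pose M := #|{: {ffun 'I_s -> 'I_N.+1}}|.
pose F k := if insub k is Some j then cube (enum_val (j : 'I_M)) else set0.
have F0 k : (M <= k)%N -> F k = set0 by move=> Mk; rewrite /F insubF// ltnNge Mk.
have dF k : diam (F k) <= (Num.sqrt s%:R / N%:R)%:E.
  by rewrite /F; case: insubP => [j _ _|_]; [exact: dcube|rewrite diam_set0 leNye].
have FE k : hausdorff_gauge s (F k) <= (ball_volume s * (Num.sqrt s%:R / N%:R / 2) ^+ s)%:E.
  by apply: hausdorff_gauge_le (dF k); rewrite divr_ge0// ltW.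
apply: (@le_trans _ _ (\sum_(k <oo) hausdorff_gauge s (F k))).
  apply: ereal_inf_lbound; exists F => //; split; last first.
    by move=> k; rewrite (le_trans (dF k))// lee_fin.
  move=> x Qx; pose j := [ffun i => inord (Num.truncn (N%:R * x ord0 i)%R) : 'I_N.+1].
  exists (enum_rank j) => //.
  rewrite /F insubT /=; first exact: ltn_ord.
  move=> lt; rewrite (_ : Sub _ _ = enum_rank j) ?enum_rankK; last exact/val_inj.
  move=> i; rewrite /j ffunE; have /andP[x0 x1] := Qx i.
  have Nx0 : (0 <= N%:R * x ord0 i)%R by rewrite mulr_ge0// ltW.
  rewrite inordK; last first.
    rewrite ltnS -(ler_nat R) (le_trans (y := (N%:R * x ord0 i)%R))// ?truncn_le//.
    by rewrite ger_pMr.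
  apply/andP; split; first by rewrite truncn_le.
  by rewrite natr1 ltW//; exact: truncnS_gt.
rewrite (nneseries_split 0 M); last by move=> k _; exact: hausdorff_gauge_ge0.
rewrite add0n [X in _ + X]eseries0 ?adde0; last first.
  by move=> k Mk _; rewrite F0// /hausdorff_gauge eqxx.
apply: (@le_trans _ _ (\sum_(0 <= k < M) (ball_volume s * (Num.sqrt s%:R / N%:R / 2) ^+ s)%:E)).
  by apply: lee_sum => k _; exact: FE.
rewrite sumEFin lee_fin sumr_const_nat subn0 -[leLHS]mulr_natl /M card_ffun !card_ord natrX.
rewrite mulrCA ler_wpM2l ?(ltW (ball_volume_gt0 _))// -exprMn.
rewrite lerXn2r ?nnegrE//.
rewrite -!mulrA mulrCA ler_piMr// mulrA ler_pdivrMr// mul1r ler_pdivrMr//.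
by rewrite -natrM ler_nat mul2n -addnn -addn1 leq_add2l.
Qed.

Lemma hausdorff_bigsetU_lty (n s : nat) (I : Type) (r : seq I) (F : I -> set 'rV[R]_n) :
  (forall i, hausdorff s (F i) < +oo) ->
  hausdorff s (\big[setU/set0]_(i <- r) F i) < +oo.
Proof.
move=> Foo; elim: r => [|i r ih]; first by rewrite big_nil hausdorff0.
rewrite big_cons; apply: (le_lt_trans (outer_measureU2 (hausdorff s) _ _)).
by apply: lte_add_pinfty; [exact: Foo|exact: ih].
Qed.

Definition face s (i : 'I_s.+1) (b : R) (y : 'rV[R]_s) : 'rV[R]_s.+1 :=
  \row_j if unlift i j is Some k then y ord0 k else b.

Lemma face_isometry s (i : 'I_s.+1) b y z :
  enorm (face i b y - face i b z) = enorm (y - z).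
Proof.
rewrite /enorm /dot (bigD1_ord i)//= !mxE unlift_none subrr mul0r add0r.
by congr Num.sqrt; apply: eq_bigr => j _; rewrite !mxE liftK.
Qed.

(* The sphere is the radial projection of the faces of the cube, which is
   1-Lipschitz outside the unit ball. *)
Lemma hausdorff_sphere_lty s : hausdorff s (@unit_sphere R s.+1) < +oo.
Proof.
pose Q := [set x : 'rV[R]_s | forall i, (-1 <= x ord0 i <= 1)%R].
have Qoo : hausdorff s Q < +oo.
  pose g (x : 'rV[R]_s) := (2 *: x - const_mx 1)%R.
  apply: (@le_lt_trans _ _ (hausdorff s (g @` [set x : 'rV[R]_s | forall i, (0 <= x ord0 i <= 1)%R]))).
    apply: le_hausdorff => x Qx; exists (2^-1 *: (x + const_mx 1))%R.
      by move=> i; rewrite !mxE; have := Qx i; lra.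
    by rewrite /g scalerA mulfV// scale1r addrK.
  apply: (le_lt_trans (@hausdorff_lipschitz _ _ _ s _ g 2 _ _)) => //.
    move=> x y _ _; rewrite /g opprB addrA subrK -scalerBr enormZ ger0_norm//.
  by rewrite lte_mul_pinfty// ?hausdorff_unit_box_lty// lee_fin exprn_ge0.
pose K := \big[setU/set0]_(ib <- index_enum ('I_s.+1 * bool)%type)
  (face ib.1 ((-1) ^+ ib.2) @` Q).
have Koo : hausdorff s K < +oo.
  apply: hausdorff_bigsetU_lty => -[i b]/=.
  apply: (le_lt_trans (@hausdorff_lipschitz _ _ _ s _ (face i _) 1 ltr01 _)).
    by move=> x y _ _; rewrite face_isometry mul1r.
  by rewrite expr1n mul1e.
have K1 y : K y -> (1 <= enorm y)%R.
  rewrite /K -bigcup_seq => -[[i b] _ [z _ <-]].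
  apply: le_trans (ler_coord_enorm _ i).
  by rewrite /= mxE unlift_none normrX normrN1 expr1n.
apply: (@le_lt_trans _ _ (hausdorff s (@normalize R s.+1 @` K))); last first.
  apply: (le_lt_trans (@hausdorff_lipschitz _ _ _ s _ (@normalize R s.+1) 1 ltr01 _)).
    move=> x y Kx Ky; rewrite mul1r -[leLHS]mul1r normalize_contract// K1//.
  by rewrite expr1n mul1e.
apply: le_hausdorff => x x1.
have x0 : mx_norm x != 0%R.
  apply/eqP => x0; have := enorm_le_norm x; rewrite x1 [`|x|%R]x0 mulr0.
  by rewrite ler10.
have m0 : (0 < mx_norm x)%R by rewrite lt0r x0 (normr_ge0 x).
have [[z i] /= xi] := mx_norm_neq0 x0.
have {z}xi : mx_norm x = `|x ord0 i|%R by rewrite xi (ord1 z).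
exists ((mx_norm x)^-1 *: x)%R; last first.
  by rewrite normalizeZ ?invr_gt0// normalize_sphere.
rewrite /K -bigcup_seq; exists (i, x ord0 i < 0)%R; first by rewrite /= mem_index_enum.
exists (\row_j ((mx_norm x)^-1 * x ord0 (lift i j)))%R.
  move=> j; rewrite mxE -ler_norml normrM ger0_norm ?invr_ge0 ?(ltW m0)//.
  by rewrite ler_pdivrMl// mulr1; exact: ler_coord_norm.
apply/rowP => j; rewrite !mxE; have [k ->|->] := unliftP i j; first by rewrite mxE.
transitivity ((mx_norm x)^-1 * ((-1) ^+ (x ord0 i < 0)%R * `|x ord0 i|))%R.
  by rewrite -xi mulrCA mulVf// mulr1.
by rewrite -realEsign ?num_real.
Qed.

(* A set of diameter [r] lies in a cube of side [2 r]; the constant [4 ^ s]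
   is not optimal. *)
Lemma lebesgue_le_hausdorff s (A : set 'rV[R]_s) : measurable A ->
  (ball_volume s)%:E * lebesgue_row s A <= (4 ^+ s)%:E * hausdorff s A.
Proof.
move=> mA; apply: (@le_trans _ _ ((4 ^+ s)%:E * hausdorff_pre s 1 A)); last first.
  by rewrite lee_pmul2l ?lte_fin ?exprn_gt0// hausdorff_pre_le.
have b0 := @ball_volume_gt0 R s.
rewrite -lee_pdivrMl ?exprn_gt0//; apply: le_ereal_inf_tmp => _ [F [AF dF] <-].
rewrite lee_pdivrMl ?exprn_gt0// -nneseriesZl//; last first.
  by move=> k _; exact: hausdorff_gauge_ge0.
have /choice[G GP] k : exists G : set 'rV[R]_s, [/\ measurable G, F k `<=` G &
    (ball_volume s)%:E * lebesgue_row s G = (4 ^+ s)%:E * hausdorff_gauge s (F k)].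
  have [F0|/set0P F0] := eqVneq (F k) set0.
    exists set0; split => //; first by rewrite F0.
    by rewrite F0 /hausdorff_gauge eqxx measure0 !mule0.
  have := dF k; rewrite (hausdorff_gaugeE s F0 (dF k)).
  have := diam_ge0 F0; have := @diam_leP _ _ (F k).
  case: (diam (F k)) => [r| |]// dr r0 _; rewrite lee_fin in r0.
  have [x Fx] := F0.
  pose B := [set y : 'rV[R]_s | forall i, (- r <= y ord0 i <= r)%R].
  exists ((fun y => 1 *: y + - x)%R @^-1` B); split.
  - rewrite -[X in measurable X]setTI; apply: measurable_rowD => //.
      by apply: measurable_rowZ => //; exact: measurable_id.
    exact: measurable_box.
  - move=> y Fy i; rewrite scale1r -ler_norml.
    by rewrite (le_trans (ler_coord_enorm _ _))// ((dr r).1 (lexx _)).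
  - rewrite lebesgue_row_affine//; last exact: measurable_box.
    rewrite lebesgue_row_box; last by lra.
    rewrite invr1 expr1n mul1e -!EFinM mulrCA -exprMn; congr (_ * _ ^+ _)%:E.
    by rewrite /=; lra.
apply: (@le_trans _ _ ((ball_volume s)%:E * \sum_(k <oo) lebesgue_row s (G k))).
  rewrite lee_pmul2l//; apply: measure_sigma_subadditive => //.
    by move=> k; have [] := GP k.
  by move=> x /AF[k _ Fx]; exists k => //; have [_ + _] := GP k; exact.
rewrite -nneseriesZl// le_eqVlt; apply/orP; left; apply/eqP; apply: eq_eseriesr => k _.
by have [] := GP k.
Qed.

(* The sphere projects orthogonally onto the ball of one dimension less. *)
Lemma hausdorff_sphere_gt0 s : 0 < hausdorff s (@unit_sphere R s.+1).
Proof.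
pose p (x : 'rV[R]_s.+1) : 'rV[R]_s := \row_j x ord0 (lift ord0 j).
have b0 := @ball_volume_gt0 R s.
have := @lebesgue_le_hausdorff s _ (measurable_eball (0 : 'rV[R]_s) 1).
have pS : hausdorff s (eball (0 : 'rV[R]_s) 1) <= hausdorff s (@unit_sphere R s.+1).
  apply: (@le_trans _ _ (hausdorff s (p @` @unit_sphere R s.+1))).
    apply: le_hausdorff => y; rewrite /eball/= subr0 => y1.
    pose a := Num.sqrt (1 - enorm y ^+ 2)%R.
    have a2 : (a ^+ 2 = 1 - enorm y ^+ 2)%R.
      by rewrite sqr_sqrtr// subr_ge0 expr_le1 ?enorm_ge0// ltW.
    exists (cons_row (a, y)); last by apply/rowP => j; rewrite mxE cons_rowS.
    rewrite /unit_sphere/= [LHS]/enorm /dot big_ord_recl cons_row0 -expr2 a2.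
    rewrite (eq_bigr (fun i => y ord0 i * y ord0 i)%R) => [|i _]; last by rewrite cons_rowS.
    by rewrite -/(dot y y) -sqr_enorm subrK sqrtr1.
  apply: le_trans (@hausdorff_lipschitz _ _ _ s _ p 1 ltr01 _) _; last by rewrite expr1n mul1e.
  move=> x y _ _; rewrite mul1r /enorm ler_wsqrtr// /dot big_ord_recl/=.
  rewrite -[leLHS]add0r lerD//; first by rewrite -expr2 sqr_ge0.
  by rewrite le_eqVlt; apply/orP; left; apply/eqP; apply: eq_bigr => j _; rewrite !mxE.
rewrite [X in (ball_volume s)%:E * X](ball_volumeE s) => h.
have : 0 < (4 ^+ s)%:E * hausdorff s (@unit_sphere R s.+1).
  apply: (@lt_le_trans _ _ ((ball_volume s)%:E * (ball_volume s)%:E : \bar R)).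
    by rewrite -EFinM lte_fin mulr_gt0.
  by rewrite (le_trans h)// lee_pmul2l// lte_fin exprn_gt0.
by rewrite pmule_rgt0// lte_fin exprn_gt0.
Qed.

End hausdorff_finite_positive.

(** * Surface measure and cone measure on the sphere *)

Section cones.
Context {R : realType} {d : nat}.
Local Open Scope ereal_scope.
Implicit Types (x n : 'rV[R]_d) (A U : set 'rV[R]_d) (r : R).

(** Truncated cone without its apex, where [normalize] is meaningless. Only the trace of [A] on the
    sphere matters, and the volume of [cone A 1] is the cone measure of that trace. *)
Definition cone A r : set 'rV[R]_d :=
  [set x | (0 < enorm x < r)%R /\ A (normalize x)].

Lemma measurable_cone A r : measurable A -> measurable (cone A r).
Proof.
move=> mA.
rewrite (_ : cone A r = (@enorm R d @^-1` `]0%R, r[%classic) `&` (@normalize R d @^-1` A)).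
  apply: measurableI; rewrite -[X in measurable X]setTI.
    exact: measurable_enorm.
  exact: measurable_normalize.
by apply/seteqP; split => x /=; rewrite in_itv.
Qed.

(** Near [x] all norms stay above [a = |x| / 2], and there [normalize] is Lipschitz with constant
    [1 / a]. *)
Lemma open_cone U r : open U -> open (cone U r).
Proof.
move=> /open_eballP oU; apply/open_eballP => x [/andP[x0 xr] /oU[e e0 eU]].
pose a := (enorm x / 2)%R; have a0 : (0 < a)%R by rewrite divr_gt0.
pose t := Num.min a (Num.min (r - enorm x) (a * e))%R.
exists t; first by rewrite !lt_min a0 subr_gt0 xr mulr_gt0.
move=> y; rewrite /eball/= !lt_min => /and3P[ya yr ye].
have xy : (`|enorm y - enorm x| <= enorm (y - x))%R by exact: ler_dist_enorm.
have ay : (a <= enorm y)%R.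
  by move: xy ya; rewrite ler_norml /a => /andP[h _]; lra.
split.
  rewrite (lt_le_trans a0 ay)/=.
  by move: xy yr; rewrite ler_norml => /andP[_ h]; lra.
apply: eU; rewrite /eball/= -(ltr_pM2l a0).
rewrite (le_lt_trans (normalize_contract a0 ay _))//.
by rewrite /a ler_pdivrMr// ler_pMr// ler1n.
Qed.

Lemma cone_scale A r : (0 < r)%R -> measurable A ->
  lebesgue_row d (cone A r) = (r ^+ d)%:E * lebesgue_row d (cone A 1).
Proof.
move=> r0 mA.
have -> : cone A 1 = (fun x => r *: x + 0)%R @^-1` cone A r.
  apply/seteqP; split => x; rewrite /cone/= addr0 normalizeZ// enormZ gtr0_norm//;
    by rewrite pmulr_rgt0// gtr_pMr.
rewrite lebesgue_row_affine//; last exact: measurable_cone.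
by rewrite muleA -EFinM -exprMn mulfV ?expr1n ?mul1e// gt_eqF.
Qed.

Lemma cone_lty A r : measurable A -> lebesgue_row d (cone A r) < +oo.
Proof.
move=> mA; have [r0|r0] := leP r 0%R.
  rewrite (_ : cone A r = set0) ?measure0//.
  by rewrite -subset0 => x [/andP[x0 xr] _]; have := lt_trans x0 xr; rewrite ltNge r0.
apply: (@le_lt_trans _ _ (lebesgue_row d (eball 0%R r))).
  rewrite le_measure ?inE//; [exact: measurable_cone|exact: measurable_eball|].
  by move=> x [/andP[_ xr] _]; rewrite /eball/= subr0.
by rewrite lebesgue_row_eball// ball_volumeE -EFinM ltry.
Qed.

Lemma cone_reflection n x r t :
  reflection n @^-1` cone (eball x r) t = cone (eball (reflection n x) r) t.
Proof.
apply/seteqP; split => y; rewrite /cone /eball/= enorm_reflection;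
  rewrite /normalize enorm_reflection -reflectionZ -(reflection_isometry n _ (reflection n x));
  by rewrite reflectionK.
Qed.

End cones.

Section spherical_measures.
Context {R : realType} {s : nat}.
Local Open Scope ereal_scope.
Local Notation d := s.+1.
Local Notation S := (@unit_sphere R d).

Lemma measurable_unit_sphere : measurable S.
Proof.
rewrite (_ : S = @enorm R d @^-1` [set 1%R])//.
by rewrite -[X in measurable X]setTI; apply: measurable_enorm.
Qed.

Let originE : [set 0%R : 'rV[R]_d] = [set x | forall i, (0 <= x ord0 i <= 0)%R].
Proof.
apply/seteqP; split => [_ -> i|x x0]; first by rewrite mxE lexx.
by apply/rowP => i; rewrite mxE; apply/eqP; rewrite eq_le andbC.
Qed.

Lemma measurable_origin : measurable [set 0%R : 'rV[R]_d].
Proof. by rewrite originE; exact: measurable_box. Qed.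

Lemma lebesgue_row_origin : lebesgue_row d [set 0%R] = 0 :> \bar R.
Proof. by rewrite originE lebesgue_row_box// subrr expr0n. Qed.

Lemma lebesgue_row_cone_setT : lebesgue_row d (cone setT 1) = (ball_volume d)%:E :> \bar R.
Proof.
rewrite -ball_volumeE (_ : @unit_ball R d = cone setT 1 `|` [set 0%R]); last first.
  apply/seteqP; split => x; rewrite /unit_ball /eball /cone/= subr0.
    have [->|x0] := eqVneq x 0%R; first by right.
    by rewrite -enorm_gt0 in x0 => x1; left; rewrite x0.
  by move=> [[/andP[]//]|->]; rewrite enorm0.
have L0 := lebesgue_row_origin.
rewrite measureU.
- by rewrite [X in _ = (_ + X)%R]L0 adde0.
- exact: (measurable_cone _ measurableT).
- exact: measurable_origin.
- by rewrite -subset0 => x [[/andP[x0 _] _] xE]; move: x0; rewrite xE enorm0 ltxx.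
Qed.

(** Image under [normalize] of Lebesgue measure on the punctured unit ball. The measure [mu] below
    is the same one, restricted to [setT] to acquire the structure of a finite measure. *)
Let cone_measure0 : {measure set 'rV[R]_d -> \bar R} :=
  measure_function_pushforward__canonical__measure_function_Measure
    (mrestr (lebesgue_row d) (@measurable_cone R d setT 1 measurableT))
    measurable_normalize.

Let cone_measure0E A : cone_measure0 A = lebesgue_row d (cone A 1).
Proof.
rewrite /cone_measure0/= /pushforward/= /mrestr; congr (lebesgue_row d _).
by apply/seteqP; split => x /=; rewrite /cone/= => -[]; [move=> ? []|].
Qed.

Let cone_measure0T : cone_measure0 setT < +oo.
Proof. by rewrite cone_measure0E cone_lty. Qed.

Let mu : {finite_measure set 'rV[R]_d -> \bar R} := mfrestr measurableT cone_measure0T.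

Let muE A : mu A = lebesgue_row d (cone A 1).
Proof. by rewrite /mu/= /mfrestr/= /mrestr setIT; exact: cone_measure0E. Qed.

Let sigma_lty : hausdorff_measure s S < +oo.
Proof. by rewrite hausdorff_measureE hausdorff_sphere_lty. Qed.

Let sigma : {finite_measure set 'rV[R]_d -> \bar R} :=
  mfrestr measurable_unit_sphere sigma_lty.

Let sigmaE A : sigma A = hausdorff s (A `&` S).
Proof. by []. Qed.

Let coneIS A r : cone (A `&` S) r = cone A r.
Proof.
apply/seteqP; split => x; rewrite /cone/=; first by move=> [? []].
move=> [/[dup] ? /andP[x0 _] Ax]; split => //; split => //.
by rewrite /unit_sphere/= enorm_normalize// -enorm_gt0.
Qed.

(** The reflection exchanging [x] and [y] maps one cap onto the other and is 1-Lipschitz. Equality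
    follows by exchanging the centres. *)
Let hausdorff_cap_le x y r : S x -> S y ->
  hausdorff s (eball y r `&` S) <= hausdorff s (eball x r `&` S).
Proof.
move=> Sx Sy; have Txy := @reflection_swap _ _ x y (etrans Sx (esym Sy)).
set T := reflection (x - y) in Txy.
apply: (@le_trans _ _ (hausdorff s (T @` (eball x r `&` S)))).
  apply: le_hausdorff => z [zy Sz]; exists (T z); last exact: reflectionK.
  split; last by rewrite /unit_sphere/= enorm_reflection.
  by rewrite /eball/= -(reflectionK (x - y) x) reflection_isometry [reflection _ x]Txy.
apply: le_trans (hausdorff_lipschitz (L := 1) s ltr01 _) _.
  by move=> u v _ _; rewrite mul1r reflection_isometry.
by rewrite expr1n mul1e.
Qed.

Let lebesgue_cap x y r : S x -> S y ->
  lebesgue_row d (cone (eball y r) 1) = lebesgue_row d (cone (eball x r) 1).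
Proof.
move=> Sx Sy; have Txy := @reflection_swap _ _ x y (etrans Sx (esym Sy)).
rewrite -[in LHS]Txy -cone_reflection.
apply: lebesgue_row_isometry.
- exact: reflection_isometry.
- exact: reflectionK.
- by apply: open_cone; exact: open_eball.
Qed.

(** The cone is open and contains [x / 2], hence a small ball around it. *)
Let lebesgue_cap_gt0 x r : (0 < r)%R -> S x -> 0 < lebesgue_row d (cone (eball x r) 1).
Proof.
move=> r0 Sx; have : cone (eball x r) 1 (2^-1 *: x)%R.
  rewrite /cone/= enormZ Sx gtr0_norm ?invr_gt0// normalizeZ ?invr_gt0//.
  rewrite normalize_sphere// mulr1 invr_gt0 ltr0n invf_lt1// ltr1n; split => //.
  exact: eball_center.
have /open_eballP/[apply] -[e e0 eC] := @open_cone R d _ 1%R (@open_eball R d x r).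
apply: (@lt_le_trans _ _ (lebesgue_row d (eball (2^-1 *: x)%R e))).
  by rewrite lebesgue_row_eball// ball_volumeE -EFinM lte_fin mulr_gt0 ?exprn_gt0 ?ball_volume_gt0.
rewrite le_measure ?inE//; first exact: measurable_eball.
by apply: measurable_cone; exact: measurable_eball.
Qed.

Lemma sphere_measure_proportional : exists2 q : R, (0 < q)%R &
  forall U, open U -> hausdorff s (U `&` S) = q%:E * lebesgue_row d (cone U 1).
Proof.
(* A base point, whose caps serve to express the common mass of all caps of radius [r]. *)
pose e : 'rV[R]_d := normalize (const_mx 1%R : 'rV[R]_d).
have Se : S e.
  apply: enorm_normalize; apply/eqP => /rowP/(_ ord0); rewrite !mxE => /eqP.
  by rewrite oner_eq0.
have mS := measurable_unit_sphere.
have HS : hausdorff s S = (fine (hausdorff s S))%:E.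
  by rewrite fineK// ge0_fin_numE ?hausdorff_ge0// hausdorff_sphere_lty.
have a0 : (0 < fine (hausdorff s S))%R by rewrite -lte_fin -HS hausdorff_sphere_gt0.
have b0 := @ball_volume_gt0 R d.
exists (fine (hausdorff s S) / ball_volume d)%R; first by rewrite divr_gt0.
have mC r : measurable (eball e r) by exact: measurable_eball.
have hfin r : lebesgue_row d (cone (eball e r) 1) =
    (fine (lebesgue_row d (cone (eball e r) 1)))%:E.
  by rewrite fineK// ge0_fin_numE// cone_lty.
have gfin r : hausdorff s (eball e r `&` S) = (fine (hausdorff s (eball e r `&` S)))%:E.
  rewrite fineK// ge0_fin_numE ?hausdorff_ge0// (le_lt_trans _ (hausdorff_sphere_lty s))//.
  by apply: le_hausdorff; exact: subIsetr.
move=> U oU.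
have sigmaS A : sigma (A `&` S) = hausdorff s (A `&` S) by rewrite sigmaE -setIA setIid.
have muS A : mu (A `&` S) = lebesgue_row d (cone A 1) by rewrite muE coneIS.
rewrite -sigmaS -muS.
apply: (@uniform_measures_proportional R d sigma mu
  (fun r => fine (hausdorff s (eball e r `&` S)))
  (fun r => fine (lebesgue_row d (cone (eball e r) 1))) _ _ S mS a0 b0) => //.
- by rewrite sigmaE setIid.
- by rewrite -[X in mu X]setTI muS lebesgue_row_cone_setT.
- by move=> r r0; rewrite -lte_fin -hfin lebesgue_cap_gt0.
- move=> x r r0 Sx; rewrite sigmaS -gfin; apply/eqP; rewrite eq_le.
  by rewrite !hausdorff_cap_le.
- by move=> x r r0 Sx; rewrite muS -hfin; exact: lebesgue_cap.
- by exists e.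
Qed.

End spherical_measures.

(** * Slicing a radial domain *)

Section hausdorff_integral.
Context {R : realType} {n : nat}.
Local Open Scope ereal_scope.

(** Change of variables along the identity, from the Caratheodory to the Borel sigma-algebra. *)
Lemma hausdorff_integralE s (D : set 'rV[R]_n) (g : 'rV[R]_n -> R) : measurable D ->
  measurable_fun setT g -> (forall x, 0 <= g x)%R ->
  hausdorff_integral s D g = \int[hausdorff_measure s]_(x in D) (g x)%:E.
Proof.
move=> mD mg g0; apply/esym.
apply: (ge0_integral_pushforward (hausdorff_borel_measurable (s := s))) => //.
  by apply/measurable_EFinP; apply: measurable_funTS.
by move=> x _; rewrite lee_fin.
Qed.

End hausdorff_integral.

Section radial_slices.
Context {R : realType} {s : nat}.
Local Notation d := s.+1.
Local Notation S := (@unit_sphere R d).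
Variables (Omega : set 'rV[R]_d) (rho : 'rV[R]_d -> R) (M : R) (N K : nat).
Hypotheses (openO : open Omega) (OmegaE : Omega = radial_domain rho)
  (rho_gt0 : forall x, S x -> 0 < rho x) (rho_le : forall x, S x -> rho x <= M)
  (N_gt0 : (0 < N)%N) (MK : M <= K%:R / N%:R).

(* The thickness of the slices is [1 / N]; [M <= K / N] ensures that the first
   [K] of them exhaust the sphere. *)
Definition level (k : nat) : R := k%:R / N%:R.

(** On the sphere this is the superlevel set [rho > t]; written through [Omega], it inherits
    openness from it. *)
Definition dilation t : set 'rV[R]_d := [set x | Omega (t *: x)].

(** On the sphere this is [level k < rho <= level (k + 1)], presented as a difference of two open
    sets because the surface and cone measures are compared on open sets. *)
Definition slice k : set 'rV[R]_d := dilation (level k) `\` dilation (level k.+1).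

Definition slice_mass k : R := fine (lebesgue_row d (cone (slice k) 1)).

(** Sliced by the norm of the point rather than by its direction, so that these sets are visibly
    Borel and disjoint. *)
Definition boundary_slice k : set 'rV[R]_d :=
  boundary Omega `&` [set x | level k < enorm x <= level k.+1].

Let N0 : 0 < N%:R :> R. Proof. by rewrite ltr0n. Qed.

Lemma level_ge0 k : 0 <= level k.
Proof. by rewrite divr_ge0. Qed.

Lemma ltr_level i j : (level i < level j) = (i < j)%N.
Proof. by rewrite ltr_pM2r ?invr_gt0// ltr_nat. Qed.

Lemma open_dilation t : open (dilation t).
Proof.
apply/open_eballP => x /= /(open_eballP Omega).1 -/(_ openO)[e e0 eO].
have t0 : 0 < `|t| + 1 by rewrite ltr_wpDl.
exists (e / (`|t| + 1)); first by rewrite divr_gt0.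
move=> y xy; apply: eO; rewrite /eball/= -scalerBr enormZ.
rewrite (le_lt_trans (y := (`|t| + 1) * enorm (y - x)))//.
  by rewrite ler_wpM2r ?enorm_ge0// lerDl.
by rewrite mulrC -ltr_pdivlMr.
Qed.

Lemma dilationP t x : 0 <= t -> S x -> dilation t x <-> t < rho x.
Proof.
rewrite le_eqVlt => /predU1P[<-|t0] Sx; rewrite /dilation/= OmegaE.
  by rewrite scale0r; split => _; [exact: rho_gt0|left].
rewrite /radial_domain/= enormZ Sx mulr1 gtr0_norm// normalizeZ// normalize_sphere// t0.
split => [[/eqP|//]|->]; last by right.
by rewrite scaler_eq0 gt_eqF//= -enorm_eq0 Sx oner_eq0.
Qed.

Lemma sliceP k x : S x -> slice k x <-> level k < rho x <= level k.+1.
Proof.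
move=> Sx; split.
  move=> [/(dilationP (level_ge0 _) Sx) -> /= h]; rewrite leNgt; apply/negP => h'.
  by apply: h; apply/(dilationP (level_ge0 _) Sx).
move=> /andP[h1 h2]; split; first exact/(dilationP (level_ge0 _) Sx).
by move/(dilationP (level_ge0 _) Sx); rewrite ltNge h2.
Qed.

Lemma slice_ex x : S x -> exists2 k, (k < K)%N & slice k x.
Proof.
move=> Sx; have ex : exists k, rho x <= level k.
  by exists K; rewrite (le_trans (rho_le Sx)).
have [[|k] xk kmin] := ex_minnP ex.
  by move: xk; rewrite /level mul0r leNgt rho_gt0.
have kK : (k < K)%N by apply: kmin; rewrite (le_trans (rho_le Sx)).
exists k => //; apply/sliceP => //; rewrite xk andbT ltNge.
by apply/negP => /kmin; rewrite ltnn.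
Qed.

Lemma measurable_slice k : measurable (slice k).
Proof. by apply: measurableD; apply: open_row_measurable; exact: open_dilation. Qed.

Lemma normalize_in_sphere x : x != 0 -> S (normalize x).
Proof. exact: enorm_normalize. Qed.

Local Open Scope ereal_scope.

Lemma slice_massE k : lebesgue_row d (cone (slice k) 1) = (slice_mass k)%:E.
Proof. by rewrite fineK// ge0_fin_numE// cone_lty//; exact: measurable_slice. Qed.

Lemma slice_mass_ge0 k : (0 <= slice_mass k)%R.
Proof. by rewrite -lee_fin -slice_massE. Qed.

Lemma lebesgue_dilation k : lebesgue_row d (cone (dilation (level k)) 1) =
  (slice_mass k)%:E + lebesgue_row d (cone (dilation (level k.+1)) 1).
Proof.
have mU j : measurable (cone (dilation (level j)) 1).
  by apply: measurable_cone; apply: open_row_measurable; exact: open_dilation.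
have mA : measurable (cone (slice k) 1).
  by apply: measurable_cone; exact: measurable_slice.
rewrite -slice_massE -measureU//.
  congr (lebesgue_row d _); apply/seteqP; split => x.
    move=> [x01 Ux]; have [Ux'|Ux'] := pselect (dilation (level k.+1) (normalize x)).
      by right.
    by left; split => //; split.
  move=> [[x01 []]//|[/[dup] x01 /andP[x0 _] Ux]]; split => //.
  have Sx : S (normalize x) by apply: normalize_in_sphere; rewrite -enorm_gt0.
  apply/(dilationP (level_ge0 _) Sx).
  move/(dilationP (level_ge0 _) Sx) : Ux; apply: lt_trans.
  by rewrite ltr_level.
by rewrite -subset0 => x [[_ [_ +]] [_ ?]].
Qed.

(** Telescoping: every direction lies above level 0 since [rho > 0], and none above level [K] since
    [rho <= M <= K / N]. *)
Lemma sum_slice_mass : (\sum_(k < K) slice_mass k = ball_volume d)%R.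
Proof.
have sumE n : lebesgue_row d (cone (dilation (level 0)) 1) =
    (\sum_(k < n) slice_mass k)%:E + lebesgue_row d (cone (dilation (level n)) 1).
  elim: n => [|n ->]; first by rewrite big_ord0 add0e.
  by rewrite lebesgue_dilation big_ord_recr/= EFinD addeA.
apply: EFin_inj; rewrite -lebesgue_row_cone_setT.
have -> : cone setT 1 = cone (dilation (level 0)) 1.
  apply/seteqP; split => x [/[dup] x01 /andP[x0 _] _]; split => //.
  have Sx : S (normalize x) by apply: normalize_in_sphere; rewrite -enorm_gt0.
  by apply/(dilationP (level_ge0 _) Sx); rewrite /level mul0r rho_gt0.
rewrite (sumE K) (_ : cone (dilation (level K)) 1 = set0) ?measure0 ?adde0//.
rewrite -subset0 => x [/[dup] x01 /andP[x0 _]].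
have Sx : S (normalize x) by apply: normalize_in_sphere; rewrite -enorm_gt0.
by move/(dilationP (level_ge0 _) Sx); rewrite ltNge (le_trans (rho_le Sx)).
Qed.

(** Substitute for polar coordinates: apart from the origin, [W] is covered by the cones of height
    [t k] over the slices, whose volumes scale like [t k ^ d]. *)
Lemma lebesgue_le_slices (W : set 'rV[R]_d) (t : nat -> R) : measurable W ->
  (forall k, 0 < t k)%R ->
  (forall k x, x != 0%R -> slice k (normalize x) -> W x -> enorm x < t k)%R ->
  lebesgue_row d W <= (\sum_(k < K) t k ^+ d * slice_mass k)%:E.
Proof.
move=> mW t0 tW.
pose F k := cone (slice k) (t k).
have mF k : measurable (F k) by apply: measurable_cone; exact: measurable_slice.
apply: (@le_trans _ _ (lebesgue_row d ([set 0%R] `|` \big[setU/set0]_(k < K) F k))).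
  rewrite le_measure ?inE//.
    apply: measurableU; first exact: measurable_origin.
    exact: bigsetU_measurable.
  move=> x Wx; have [->|x0] := eqVneq x 0%R; first by left.
  right; have [k kK xk] := slice_ex (normalize_in_sphere x0).
  rewrite -bigcup_seq/=; exists (Ordinal kK); first by rewrite /= mem_index_enum.
  by split => //; rewrite enorm_gt0 x0 (tW k).
apply: (le_trans (measureU2 _ _ _)).
- exact: measurable_origin.
- exact: bigsetU_measurable.
rewrite [X in X + _]lebesgue_row_origin add0e.
apply: (le_trans (Boole_inequality _ _)); first by [].
rewrite -sumEFin; apply: lee_sum => k _.
by rewrite EFinM -slice_massE -cone_scale//; exact: measurable_slice.
Qed.

Lemma radial_volume_le :
  lebesgue_row d Omega <= (\sum_(k < K) level k.+1 ^+ d * slice_mass k)%:E.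
Proof.
apply: (lebesgue_le_slices (t := fun k => level k.+1)).
- exact: open_row_measurable.
- by move=> k; rewrite divr_gt0.
- move=> k x x0; have Sx := normalize_in_sphere x0.
  move=> /(sliceP _ Sx)/andP[_ h]; rewrite OmegaE => -[/eqP|/andP[_ h']].
    by rewrite (negbTE x0).
  exact: lt_le_trans h' h.
Qed.

(** The slice bound is applied to the union with the ball, of height at most [max(level (k + 1), 1)]
    over each slice; the volume of the ball, which is the sum of the slice masses, is then
    subtracted. *)
Lemma radial_excess_le : lebesgue_row d (Omega `\` unit_ball) <=
  (\sum_(k < K) (Num.max (level k.+1) 1 ^+ d - 1) * slice_mass k)%:E.
Proof.
have mO := open_row_measurable openO.
have mB : measurable (@unit_ball R d) by exact: measurable_eball.
have : lebesgue_row d (Omega `|` unit_ball) <=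
    (\sum_(k < K) (Num.max (level k.+1) 1) ^+ d * slice_mass k)%:E.
  apply: (lebesgue_le_slices (t := fun k => Num.max (level k.+1) 1%R)).
  - exact: measurableU.
  - by move=> k; rewrite lt_max ltr01 orbT.
  - move=> k x x0; have Sx := normalize_in_sphere x0.
    move=> /(sliceP _ Sx)/andP[_ h]; rewrite OmegaE lt_max => -[[/eqP|/andP[_ h']]|].
    + by rewrite (negbTE x0).
    + by rewrite (lt_le_trans h' h).
    + by rewrite /unit_ball /eball/= subr0 => ->; rewrite orbT.
have -> : Omega `|` unit_ball = (Omega `\` unit_ball) `|` unit_ball.
  apply/seteqP; split => x; last by move=> [[]|]; [left|right].
  by have [Bx|nBx] := pselect (unit_ball x); [right|move=> [Ox|//]; left; split].
rewrite measureU//; last 2 first.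
- exact: measurableD.
- by rewrite -subset0 => x [[_ +] ?]; exact.
rewrite [X in _ + X]ball_volumeE -leeBrDr// => /le_trans; apply.
rewrite -EFinB lee_fin -sum_slice_mass -sumrB.
by apply: ler_sum => k _; rewrite mulrBl mul1r.
Qed.

Lemma measurable_boundary : measurable (boundary Omega).
Proof.
apply: measurableD; last by apply: open_row_measurable; exact: open_interior.
rewrite -[closure _]setCK; apply: measurableC; apply: open_row_measurable.
by apply: closed_openC; exact: closed_closure.
Qed.

Lemma measurable_boundary_slice k : measurable (boundary_slice k).
Proof.
apply: measurableI; first exact: measurable_boundary.
rewrite (_ : [set _ | _] = (@enorm R d) @^-1` `]level k, level k.+1]).
  by rewrite -[X in measurable X]setTI; exact: measurable_enorm.
by apply/seteqP; split => x /=; rewrite in_itv.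
Qed.

Lemma trivIset_boundary_slice (D : set nat) : trivIset D boundary_slice.
Proof.
apply: sub_trivIset (subsetT D) _; apply/trivIsetP => i j _ _ ij.
rewrite -subset0 => x [[_ /= /andP[ix xi]] [_ /= /andP[jx xj]]].
move: (lt_le_trans ix xj) (lt_le_trans jx xi); rewrite !ltr_level !ltnS => h1 h2.
by move: ij; rewrite eqn_leq h1 h2.
Qed.

(** The point lies outside [Omega] but is approached from inside along its ray. Hence the radial
    projection of the boundary covers the sphere. *)
Lemma boundary_radial x : S x -> boundary Omega (rho x *: x)%R.
Proof.
move=> Sx; have rx := rho_gt0 Sx; split; last first.
  move=> /interior_subset; rewrite OmegaE /radial_domain/= => -[/eqP|].
    by rewrite scaler_eq0 gt_eqF//= -enorm_eq0 Sx oner_eq0.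
  by rewrite enormZ Sx mulr1 gtr0_norm// normalizeZ// normalize_sphere// ltxx andbF.
move=> B /nbhs_ballP[e /= e0 eB].
(* The first entry keeps [t] positive, the second keeps [t x] within [e / 2] of the boundary
   point. *)
pose t := Num.max (rho x / 2)%R (rho x - e / 2)%R.
have t0 : (0 < t)%R by rewrite lt_max divr_gt0.
have tr : (t < rho x)%R.
  by rewrite gt_max ltr_pdivrMr// ltr_pMr// ltr1n/= gtrBl divr_gt0.
exists (t *: x)%R; split.
  exact/(dilationP (ltW t0) Sx).
apply: eB; rewrite -ball_normE/= -scalerBl (le_lt_trans (norm_le_enorm _))//.
rewrite enormZ Sx mulr1 gtr0_norm ?subr_gt0// ltrBlDl -ltrBlDr.
apply: (@lt_le_trans _ _ (rho x - e / 2)%R); last by rewrite le_max lexx orbT.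
by rewrite ltrD2l ltrN2 ltr_pdivrMr// ltr_pMr// ltr1n.
Qed.

(* [normalize] maps the boundary slice onto the spherical slice and is
   [1 / level k]-Lipschitz on it. *)
Lemma hausdorff_boundary_slice k : (0 < s)%N ->
  (level k ^+ s)%:E * hausdorff s (slice k `&` S) <= hausdorff s (boundary_slice k).
Proof.
(* At level 0 the projection is not Lipschitz, but the bound is trivial because [0 ^ s = 0] for
   [s > 0]. *)
move=> s0; have := level_ge0 k; rewrite le_eqVlt => /predU1P[<-|r0].
  by rewrite expr0n eqn0Ngt s0 mul0e hausdorff_ge0.
rewrite muleC -lee_pdivlMr ?exprn_gt0// muleC -exprVn.
apply: (@le_trans _ _ (hausdorff s (@normalize R d @` boundary_slice k))).
  apply: le_hausdorff => x [kx Sx]; exists (rho x *: x)%R.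
    split; first exact: boundary_radial.
    by rewrite /= enormZ Sx mulr1 gtr0_norm ?rho_gt0//; exact/sliceP.
  by rewrite normalizeZ ?rho_gt0// normalize_sphere.
apply: hausdorff_lipschitz; first by rewrite invr_gt0.
move=> x y [_ /= /andP[kx _]] [_ /= /andP[ky _]].
by rewrite -ler_pdivrMl ?invr_gt0// invrK normalize_contract// ltW.
Qed.

(** A slice is not open, so proportionality is applied to the two dilations bounding it;
    subadditivity of [hausdorff s] then gives the lower bound by subtraction. *)
Lemma hausdorff_slice (q : R) : (0 < q)%R ->
  (forall U, open U -> hausdorff s (U `&` S) = q%:E * lebesgue_row d (cone U 1)) ->
  forall k, (q * slice_mass k)%:E <= hausdorff s (slice k `&` S).
Proof.
move=> q0 qP k.
have fin j : lebesgue_row d (cone (dilation (level j)) 1) \is a fin_num.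
  by rewrite ge0_fin_numE// cone_lty//; apply: open_row_measurable; exact: open_dilation.
have : hausdorff s (dilation (level k) `&` S) <=
    hausdorff s (slice k `&` S) + hausdorff s (dilation (level k.+1) `&` S).
  apply: (le_trans _ (outer_measureU2 (hausdorff s) _ _)).
  apply: le_hausdorff => x [Ux Sx].
  have [Ux'|Ux'] := pselect (dilation (level k.+1) x); first by right.
  by left; split => //; split.
rewrite (qP (dilation (level k))); last exact: open_dilation.
rewrite (qP (dilation (level k.+1))); last exact: open_dilation.
rewrite lebesgue_dilation -(fineK (fin k.+1)) -EFinD -!EFinM -leeBlDr//.
by rewrite -EFinB mulrDr addrK.
Qed.

Lemma integral_boundary_ge (g : 'rV[R]_d -> R) (v : nat -> R) :
  measurable_fun setT g -> (forall x, 0 <= g x)%R ->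
  (forall k, 0 <= v k)%R ->
  (forall k x, boundary_slice k x -> v k <= g x)%R ->
  \sum_(k < K) (v k)%:E * hausdorff s (boundary_slice k) <=
  \int[hausdorff_measure s]_(x in boundary Omega) (g x)%:E.
Proof.
move=> mg g0 v0 vg.
have mEg D : measurable_fun D (fun x => (g x)%:E).
  by apply/measurable_EFinP; apply: measurable_funTS.
apply: (@le_trans _ _ (\int[hausdorff_measure s]_(x in \big[setU/set0]_(k <- index_enum 'I_K) boundary_slice k) (g x)%:E)); last first.
  apply: ge0_subset_integral => //.
  - by apply: bigsetU_measurable => k _; exact: measurable_boundary_slice.
  - exact: measurable_boundary.
  - by move=> x _; rewrite lee_fin.
  - by rewrite -bigcup_seq; apply: bigcup_sub => k _; exact: subIsetl.
rewrite ge0_integral_bigsetU//=.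
- apply: lee_sum => k _; rewrite -hausdorff_measureE.
  rewrite -integral_cst; last exact: measurable_boundary_slice.
  apply: ge0_le_integral => //.
  - exact: measurable_boundary_slice.
  - by move=> x _; rewrite lee_fin.
  - by move=> x kx; rewrite lee_fin vg.
- by move=> k; exact: measurable_boundary_slice.
- exact: index_enum_uniq.
- apply/trivIsetP => i j _ _ ij.
  by have /trivIsetP := @trivIset_boundary_slice setT; exact.
- by move=> x _; rewrite lee_fin.
Qed.

Lemma radial_energy_ge (q : R) : (0 < s)%N -> (0 < q)%R ->
  (forall U, open U -> hausdorff s (U `&` S) = q%:E * lebesgue_row d (cone U 1)) ->
  (\sum_(k < K) q * ((1 + level k ^+ 2) * level k ^+ s * slice_mass k))%:E <=
  hausdorff s (boundary Omega) +
  hausdorff_integral s (boundary Omega) (fun x => enorm x ^+ 2)%R.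
Proof.
move=> s0 q0 qP; have mB := measurable_boundary.
rewrite hausdorff_integralE//; last 2 first.
- by apply: measurable_funX; exact: measurable_enorm.
- by move=> x; rewrite sqr_ge0.
(* Weight 1 on the slices yields the perimeter; weight [level k ^ 2], in [P2], yields the integral
   of [|x|^2]. *)
have P1 := @integral_boundary_ge (cst 1%R) (cst 1%R) (measurable_cst _)
  (fun=> ler01) (fun=> ler01) (fun _ _ _ => lexx _).
have E1 : \int[hausdorff_measure s]_(x in boundary Omega) (cst 1%R x)%:E =
    hausdorff s (boundary Omega).
  transitivity (\int[hausdorff_measure s]_(x in boundary Omega) cst 1 x); first by [].
  by rewrite integral_cst// mul1e.
rewrite E1 in P1.
have P2 := @integral_boundary_ge (fun x => enorm x ^+ 2)%R (fun k => level k ^+ 2)%R.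
apply: le_trans (leeD P1 (P2 _ _ _ _)).
- rewrite -big_split/= -sumEFin; apply: lee_sum => k _.
  rewrite -ge0_muleDl ?lee_fin ?sqr_ge0// -EFinD.
  rewrite (_ : (q * _)%R = (1 + level k ^+ 2) * (level k ^+ s * (q * slice_mass k)))%R; last by ring.
  rewrite EFinM lee_pmul2l ?lte_fin ?ltr_pwDl ?sqr_ge0//.
  apply: le_trans (hausdorff_boundary_slice k s0).
  rewrite EFinM; apply: lee_wpmul2l; first by rewrite lee_fin exprn_ge0// level_ge0.
  exact: hausdorff_slice.
- by apply: measurable_funX; exact: measurable_enorm.
- by move=> x; rewrite sqr_ge0.
- by move=> k; rewrite sqr_ge0.
- move=> k x [_ /= /andP[kx _]].
  by rewrite lerXn2r ?nnegrE ?enorm_ge0 ?level_ge0// ltW.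
Qed.

End radial_slices.

(** * The quantitative inequality *)

Section real_inequalities.
Context {R : realFieldType}.

Lemma expr_lipschitz (n : nat) (x y M : R) : 0 <= x -> x <= y -> y <= M ->
  y ^+ n.+1 - x ^+ n.+1 <= n.+1%:R * M ^+ n * (y - x).
Proof.
move=> x0 xy yM; have y0 := le_trans x0 xy; have M0 := le_trans y0 yM.
rewrite subrXX mulrC ler_wpM2r ?subr_ge0//.
rewrite (le_trans (y := \sum_(i < n.+1) M ^+ n))//; last first.
  by rewrite sumr_const card_ord mulr_natl.
apply: ler_sum => i _; rewrite (le_trans (y := M ^+ (n - i) * M ^+ i))//; last first.
  by rewrite -exprD subnK// -ltnS.
rewrite ler_pM ?exprn_ge0//; apply: lerXn2r => //; rewrite ?nnegrE//.
exact: le_trans yM.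
Qed.

(* Discretized [int (1 + rho^2) rho^s - 2 >= int (rho - 1)_+^2], which uses
   [(1 + r^2) r^s - 2 r^(s+1) = (1 - r)^2 r^s] and [int rho^(s+1) = int 1];
   here [eps] is the thickness of the slices. *)
Lemma sliced_inequality (s K : nat) (M q b V X eps : R) (r p : 'I_K -> R) :
  let D := s.+1%:R * M ^+ s in
  1 <= M -> 0 < q -> 0 < b -> 0 <= V -> 0 < eps ->
  (forall k, 0 <= p k) -> (forall k, 0 <= r k) -> (forall k, r k + eps <= M) ->
  \sum_k p k = b ->
  \sum_k q * ((1 + r k ^+ 2) * r k ^+ s * p k) <= X ->
  b <= \sum_k (r k + eps) ^+ s.+1 * p k ->
  V <= \sum_k (Num.max (r k + eps) 1 ^+ s.+1 - 1) * p k ->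
  q * (V ^+ 2 / (D ^+ 2 * b)) <= X - 2 * q * b + eps * (q * (2 * V / D + 2 * D * b)).
Proof.
move=> D M1 q0 b0 V0 eps0 p0 r0 rM sump XE volE VE.
have D0 : 0 < D.
  by rewrite mulr_gt0// exprn_gt0// (lt_le_trans ltr01).
pose t k := Num.max (r k - 1) 0.
pose m := \sum_k t k * p k.
have hV : V <= D * (m + eps * b).
  rewrite (le_trans VE)// -[X in _ * (_ + _ * X)]sump [X in m + X]mulr_sumr.
  rewrite /m -big_split/= mulr_sumr; apply: ler_sum => k _.
  rewrite -mulrDl mulrA ler_wpM2r//.
  have [h|h] := leP (r k + eps) 1.
    rewrite expr1n subrr mulr_ge0 ?(ltW D0)// addr_ge0 ?(ltW eps0)//.
    by rewrite le_max lexx orbT.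
  have := @expr_lipschitz s 1 (r k + eps) M ler01 (ltW h) (rM k).
  rewrite expr1n => /le_trans; apply; rewrite ler_wpM2l ?(ltW D0)//.
  by rewrite addrAC lerD2r le_max lexx.
pose B := \sum_k r k ^+ s.+1 * p k.
have hb : b <= B + D * eps * b.
  rewrite (le_trans volE)// -[X in _ <= _ + _ * X]sump mulr_sumr -big_split/=.
  apply: ler_sum => k _; rewrite -mulrDl ler_wpM2r// -lerBlDl.
  have := @expr_lipschitz s (r k) (r k + eps) M (r0 k) _ (rM k).
  by rewrite addrAC subrr add0r; apply; rewrite lerDl ltW.
pose Q := \sum_k t k ^+ 2 * p k.
have hX : q * (2 * B + Q) <= X.
  rewrite (le_trans _ XE)// -mulr_sumr ler_pM2l// mulr_sumr -big_split/=.
  apply: ler_sum => k _; rewrite mulrA -mulrDl ler_wpM2r//.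
  have rs0 : 0 <= r k ^+ s by rewrite exprn_ge0.
  (* Where [r k > 1] the factor [r k ^ s] is at least 1; elsewhere [t k] vanishes. *)
  have : t k ^+ 2 <= (r k - 1) ^+ 2 * r k ^+ s.
    rewrite /t; have [rk|rk] := leP (r k - 1) 0; first by rewrite expr0n/= mulr_ge0 ?sqr_ge0.
    rewrite -[leLHS]mulr1 ler_wpM2l ?sqr_ge0// exprn_ege1//.
    by move: rk; rewrite subr_gt0 => /ltW.
  by rewrite [r k ^+ s.+1]exprS; move: (t k) (r k) (r k ^+ s) => u w v; lra.
(* Cauchy-Schwarz for the weights [p], obtained from the nonnegative variance about the mean
   [m / b]. *)
have hQ : m ^+ 2 / b <= Q.
  have : 0 <= \sum_k (t k - m / b) ^+ 2 * p k.
    by apply: sumr_ge0 => k _; rewrite mulr_ge0 ?sqr_ge0.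
  have -> : \sum_k (t k - m / b) ^+ 2 * p k = Q - 2 * (m / b) * m + (m / b) ^+ 2 * b.
    rewrite -sump !mulr_sumr -sumrB -big_split/=; apply: eq_bigr => k _; ring.
  suff -> : Q - 2 * (m / b) * m + (m / b) ^+ 2 * b = Q - m ^+ 2 / b by rewrite subr_ge0.
  by field; rewrite gt_eqF.
(* With [u = V / D] and [v = eps b] this is [u^2 - 2 u v <= (u - v)^2 <= m^2]; if [u <= v] the
   left-hand side is already nonpositive. *)
have hm : (V / D) ^+ 2 - 2 * (V / D) * (eps * b) <= m ^+ 2.
  have : V / D <= m + eps * b by rewrite ler_pdivrMr// mulrC.
  have : 0 <= V / D by rewrite divr_ge0// ltW.
  have : 0 <= eps * b by rewrite mulr_ge0// ltW.
  move: (V / D) (eps * b) => u v v0 u0 uv; have [h|h] := leP u v; first by nra.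
  have : (u - v) ^+ 2 <= m ^+ 2 by rewrite lerXn2r ?nnegrE//; lra.
  by have := sqr_ge0 v; lra.
have hm' : V ^+ 2 / (D ^+ 2 * b) - eps * (2 * V / D) <= m ^+ 2 / b.
  rewrite -[leLHS](mulfK (lt0r_neq0 b0)) ler_pM2r ?invr_gt0//.
  rewrite (le_trans _ hm)// le_eqVlt; apply/orP; left; apply/eqP.
  by field; rewrite !gt_eqF.
apply: (@le_trans _ _ (q * (2 * B + Q - 2 * b + eps * (2 * V / D + 2 * D * b)))); last by lra.
rewrite ler_pM2l//.
move: hm' hQ hb; move: (V ^+ 2 / _) (2 * V / D) (m ^+ 2 / b) => u v w; lra.
Qed.

End real_inequalities.

Section radial_stability.
Context {R : realType}.

(** The measure of the sphere is added on the left instead of subtracted on the right, which avoids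
    differences of extended reals. *)
Lemma radial_stability (s : nat) (M : R) : (0 < s)%N -> 0 <= M ->
  exists2 c : R, 0 < c &
  forall (Omega : set 'rV[R]_s.+1) (rho : 'rV[R]_s.+1 -> R),
    open Omega -> Omega = radial_domain rho ->
    (forall x, unit_sphere x -> 0 < rho x) ->
    (forall x, unit_sphere x -> rho x <= M) ->
    volume Omega = volume (unit_ball : set 'rV[R]_s.+1) ->
    ((c * fine (volume (Omega `\` unit_ball)) ^+ 2)%:E
      + (hausdorff s (@unit_sphere R s.+1) + hausdorff s (@unit_sphere R s.+1))
     <= hausdorff s (boundary Omega) +
        hausdorff_integral s (boundary Omega) (fun x => enorm x ^+ 2)%R)%E.
Proof.
move=> s0 M0; have [q q0 qP] := sphere_measure_proportional (R := R) (s := s).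
pose b : R := ball_volume s.+1; have b0 : 0 < b := ball_volume_gt0 s.+1.
(* [M + 1] bounds all levels up to [K / N] whatever [N] is, since [K <= M N + 1] for the [K] chosen
   below. *)
pose D := s.+1%:R * (M + 1) ^+ s.
have D0 : 0 < D by rewrite mulr_gt0 ?exprn_gt0 ?ltr_wpDl.
exists (q / (D ^+ 2 * b)); first by rewrite divr_gt0// mulr_gt0// exprn_gt0.
move=> Omega rho oO OE rho0 rhoM vol.
set X := (hausdorff s (boundary Omega) + _)%E.
have -> : hausdorff s (@unit_sphere R s.+1) = (q * b)%:E.
  by rewrite -[unit_sphere]setTI qP; [rewrite lebesgue_row_cone_setT|exact: openT].
have X0 : (0 <= X)%E.
  rewrite adde_ge0 ?hausdorff_ge0// hausdorff_integralE//.
  - by apply: integral_ge0 => x _; rewrite lee_fin sqr_ge0.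
  - exact: measurable_boundary.
  - by apply: measurable_funX; exact: measurable_enorm.
  - by move=> x; rewrite sqr_ge0.
have [Xoo|Xoo] := eqVneq X +oo%E; first by rewrite Xoo leey.
have XE : X = (fine X)%:E by rewrite fineK// ge0_fin_numE// ltey.
have Vfin : volume (Omega `\` unit_ball) \is a fin_num.
  have mO := open_row_measurable oO.
  rewrite ge0_fin_numE//; apply: (@le_lt_trans _ _ (volume Omega)).
    rewrite le_measure ?inE//; apply: measurableD => //; exact: measurable_eball.
  by rewrite vol; exact: lebesgue_row_unit_ball_lty.
set V := fine _.
have V0 : 0 <= V by rewrite fine_ge0.
(* The slicing error is [E / N] with [E] independent of [N], so a large [N] makes it at most an
   arbitrary [e > 0]. *)
rewrite XE -!EFinD lee_fin; apply/ler_addgt0Pr => e e0.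
pose E := q * (2 * V / D + 2 * D * b).
have E0 : 0 <= E.
  have D0' := ltW D0; have b0' := ltW b0; have q0' := ltW q0.
  apply: mulr_ge0 => //; apply: addr_ge0; first by rewrite divr_ge0// mulr_ge0.
  by apply: mulr_ge0 => //; apply: mulr_ge0.
pose N := (Num.truncn (E / e)).+1.
have N0 : 0 < N%:R :> R by [].
have NE : N%:R^-1 * E <= e.
  rewrite mulrC ler_pdivrMr// mulrC -ler_pdivrMr//.
  by rewrite ltW// truncnS_gt.
pose K := (Num.truncn (M * N%:R)).+1.
have MK : M <= K%:R / N%:R by rewrite ler_pdivlMr// ltW// truncnS_gt.
have KM : K%:R / N%:R <= M + 1.
  rewrite ler_pdivrMr// mulrDl mul1r -[K%:R]natr1 lerD ?ler1n//.
  by rewrite truncn_le mulr_ge0.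
have levelS k : level N k + N%:R^-1 = level N k.+1 :> R.
  by rewrite /level -[k.+1%:R]natr1 mulrDl mul1r.
have N1 : (0 < N)%N by [].
have := @sliced_inequality R s K (M + 1) q b V (fine X) N%:R^-1
  (fun k => level N k) (fun k => slice_mass Omega N k).
move=> /(_ _ q0 b0 V0 _ _ _ _ _ _ _ _) h.
rewrite mulrAC -mulrA; apply: (@le_trans _ _ (fine X - 2 * q * b + N%:R^-1 * E + (q * b + q * b))).
  rewrite lerD2r; apply: h => //.
  - by rewrite lerDr.
  - by rewrite invr_gt0.
  - by move=> k; exact: slice_mass_ge0.
  - by move=> k; exact: level_ge0.
  - move=> k; rewrite levelS (le_trans _ KM)// ler_wpM2r ?invr_ge0//.
    by rewrite ler_nat.
  - exact: (sum_slice_mass oO OE rho0 rhoM N1 MK).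
  - by rewrite -lee_fin -XE; exact: (radial_energy_ge K oO OE rho0 N1 s0 q0 qP).
  - rewrite -lee_fin -ball_volumeE.
    apply: (@le_trans _ _ (volume Omega)); first by rewrite vol.
    apply: (le_trans (radial_volume_le oO OE rho0 rhoM N1 MK)).
    by rewrite lee_fin; apply: ler_sum => k _; rewrite levelS.
  - rewrite -lee_fin /V fineK//.
    apply: (le_trans (radial_excess_le oO OE rho0 rhoM N1 MK)).
    by rewrite lee_fin; apply: ler_sum => k _; rewrite levelS.
by lra.
Qed.

End radial_stability.

(** * Zolotarev distance against the volume difference *)

Section zolotarev.
Context {R : realType} {n : nat}.
Implicit Types (h : 'rV[R]_n.+1 -> R) (alpha : R).

Lemma sup_norm_ge0 (V : zmodType) (f : V -> R) (D : set 'rV[R]_n.+1) (g : 'rV[R]_n.+1 -> V) :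
  (forall v, 0 <= f v) -> D !=set0 -> (0 <= sup_norm f D g)%E.
Proof.
move=> f0 [x Dx]; apply: (@le_trans _ _ (f (g x))%:E); first by rewrite lee_fin.
by apply: ereal_sup_ubound; exists x.
Qed.

Lemma hoelder_seminorm_ge0 (V : zmodType) (f : V -> R) alpha (D : set 'rV[R]_n.+1)
    (g : 'rV[R]_n.+1 -> V) x y :
  (forall v, 0 <= f v) -> D x -> D y -> x != y -> (0 <= hoelder_seminorm f alpha D g)%E.
Proof.
move=> f0 Dx Dy xy; apply: (@le_trans _ _ (f (g x - g y) / enorm (x - y) `^ alpha)%:E).
  by rewrite lee_fin divr_ge0// powR_ge0.
by apply: ereal_sup_ubound; exists (x, y).
Qed.

(** Provides a second point of the space: a Hoelder seminorm over a single point would be the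
    supremum of the empty set, [-oo]. *)
Lemma const_mx1_neq0 : const_mx 1 != 0 :> 'rV[R]_n.+1.
Proof.
by apply/eqP => /rowP/(_ ord0); rewrite !mxE => /eqP; rewrite oner_eq0.
Qed.

Lemma hoelder_norm_le1 alpha h : (hoelder_norm alpha h <= 1)%E ->
  (forall x, `|h x| <= 1) /\
  (forall x y, `|h x - h y| <= enorm (x - y) `^ alpha).
Proof.
move=> h1.
have s0 : (0 <= sup_norm Num.norm setT h)%E.
  by apply: sup_norm_ge0 => //; exists 0.
have t0 : (0 <= hoelder_seminorm Num.norm alpha setT h)%E.
  by apply: hoelder_seminorm_ge0 (const_mx1_neq0).
split => [x|x y].
  rewrite -lee_fin; apply: (@le_trans _ _ (sup_norm Num.norm setT h)).
    by apply: ereal_sup_ubound; exists x.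
  by apply: le_trans h1; rewrite leeDl.
have [->|xy] := eqVneq x y; first by rewrite !subrr normr0 powR_ge0.
have : ((`|h x - h y| / enorm (x - y) `^ alpha)%:E <= 1)%E.
  apply: (@le_trans _ _ (hoelder_seminorm Num.norm alpha setT h)).
    by apply: ereal_sup_ubound; exists (x, y).
  by apply: le_trans h1; rewrite leeDr.
by rewrite lee_fin ler_pdivrMr ?mul1r// powR_gt0// enorm_gt0 subr_eq0.
Qed.

Lemma hoelder_measurable alpha h : 0 < alpha ->
  (forall x y, `|h x - h y| <= enorm (x - y) `^ alpha) -> measurable_fun setT h.
Proof.
move=> a0 hh; apply: continuous_row_measurable => x.
apply/(@cvgrPdist_lt _ _ _ (nbhs x) (nbhs_filter x)) => e e0.
have d0 : 0 < e `^ alpha^-1 by rewrite powR_gt0.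
have : nbhs x (eball x (e `^ alpha^-1)).
  by apply: open_nbhs_nbhs; split; [exact: open_eball|exact: eball_center].
apply: filterS => y xy; rewrite (le_lt_trans (hh _ _))//.
have eE : (e `^ alpha^-1) `^ alpha = e.
  by rewrite -powRrM mulVf ?gt_eqF// powRr1// ltW.
by rewrite -[ltRHS]eE gt0_ltr_powR ?nnegrE ?enorm_ge0 ?powR_ge0// enormB.
Qed.

(** Equal volumes make the prefactor 1, so the integrals over the intersection cancel. Since
    [|h| <= 1], what remains is at most [|A \ B| + |B \ A|], and these two volumes coincide. *)
Lemma zolotarev_le alpha (A B : set 'rV[R]_n.+1) : 0 < alpha ->
  measurable A -> measurable B -> volume A = volume B ->
  (0 < volume B < +oo)%E ->
  (zolotarev alpha A B <= (2 * fine (volume (A `\` B)))%:E)%E.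
Proof.
move=> a0 mA mB vol /andP[B0 Boo].
apply: ge_ereal_sup => _ [h /= /hoelder_norm_le1[h1 hh] <-].
have mh := hoelder_measurable a0 hh.
rewrite vol divff ?mul1r; last by rewrite gt_eqF// fine_gt0// B0.
have int D : measurable D -> (volume D < +oo)%E -> (lebesgue_row n.+1).-integrable D (EFin \o h).
  move=> mD Doo; apply: measurable_bounded_integrable => //.
    exact: measurable_funTS.
  by exists 1; split => // t t1 x _ /=; rewrite (le_trans (h1 x))// ltW.
have sub D E : measurable D -> measurable E -> D `<=` E -> (volume E < +oo)%E -> (volume D < +oo)%E.
  by move=> mD mE DE; apply: le_lt_trans; rewrite le_measure ?inE.
have Aoo : (volume A < +oo)%E by rewrite vol.
have split D E : measurable D -> measurable E -> (volume D < +oo)%E ->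
    \int[lebesgue_row n.+1]_(x in D) h x =
    \int[lebesgue_row n.+1]_(x in D `&` E) h x + \int[lebesgue_row n.+1]_(x in D `\` E) h x.
  move=> mD mE Doo; rewrite -Rintegral_setU//; last 4 first.
  - exact: measurableI.
  - exact: measurableD.
  - by rewrite setUIDK; exact: int.
  - by rewrite disj_set2E setDE setIACA setICr setI0.
  by rewrite setUIDK.
have bound D : measurable D -> (volume D < +oo)%E ->
    `|\int[lebesgue_row n.+1]_(x in D) h x| <= fine (volume D).
  move=> mD Doo; rewrite (le_trans (le_normr_Rintegral _ (int _ _ _)))//.
  rewrite -[leRHS]mul1r -Rintegral_cst//; apply: le_Rintegral => //.
  - apply: measurable_bounded_integrable => //.
      by apply: measurableT_comp => //; exact: measurable_funTS.
    by exists 1; split => // t t1 x _ /=; rewrite normr_id (le_trans (h1 x))// ltW.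
  - apply: measurable_bounded_integrable => //.
    by exists 1; split => // t t1 x _ /=; rewrite normr1 ltW.
have volBA : volume (B `\` A) = volume (A `\` B).
  have volD D E : measurable D -> measurable E -> (volume D < +oo)%E ->
    (volume (D `\` E) = volume D - volume (D `&` E))%E by move=> *; exact: measureD.
  by rewrite !volD// vol setIC.
have mAB : measurable (A `\` B) by exact: measurableD.
have mBA : measurable (B `\` A) by exact: measurableD.
have ABoo : (volume (A `\` B) < +oo)%E by apply: sub Aoo => //; exact: subDsetl.
rewrite lee_fin (split B A)// (split A B)// setIC opprD addrACA subrr add0r.
rewrite (le_trans (ler_normB _ _))// mulr_natl mulr2n lerD//.
  by rewrite -volBA bound// volBA.
exact: bound.
Qed.

(** The test function 0 is admissible. Nonnegativity is what allows the bound on the distance to be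
    squared. *)
Lemma zolotarev_ge0 alpha (A B : set 'rV[R]_n.+1) : (0 <= zolotarev alpha A B)%E.
Proof.
apply: le_trans (ereal_sup_ubound _); last first.
  exists (cst 0); last reflexivity.
  rewrite /= /hoelder_norm [X in (X + _)%E](_ : _ = 0%E).
    rewrite add0e; apply: ge_ereal_sup => _ [p _ <-].
    by rewrite lee_fin subrr normr0 mul0r.
  rewrite /sup_norm -[RHS](@ereal_sup1 R); congr ereal_sup.
  by apply/seteqP; split => [_ [x _ <-]|_ ->]; [rewrite /= normr0|exists 0; rewrite ?normr0].
by rewrite lee_fin.
Qed.

End zolotarev.

Section radius_bound.
Context {R : realType} {n : nat}.

(** Two distinct points of the sphere make the Hoelder seminorm of the gradient nonnegative, so that
    the full norm dominates the sup norm. *)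
Lemma unit_sphere_opposite : exists x : 'rV[R]_n.+1,
  [/\ unit_sphere x, unit_sphere (- x) & x != - x].
Proof.
exists (normalize (const_mx 1)); have x1 := enorm_normalize (@const_mx1_neq0 R n).
split; [by []|by rewrite /unit_sphere/= enormN|].
by rewrite -subr_eq0 opprK -mulr2n -scaler_nat scaler_eq0 pnatr_eq0/= -enorm_eq0 x1 oner_eq0.
Qed.

Lemma sphere_C1alpha_norm_bound alpha (f : 'rV[R]_n.+1 -> R) (L : R) :
  (sphere_C1alpha_norm alpha f <= L%:E)%E -> forall x, unit_sphere x -> `|f x| <= L.
Proof.
move=> fL x Sx; have [e [Se SNe eNe]] := unit_sphere_opposite.
rewrite -lee_fin (le_trans _ fL)// /sphere_C1alpha_norm.
apply: (@le_trans _ _ (sup_norm Num.norm unit_sphere f)).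
  by apply: ereal_sup_ubound; exists x.
rewrite -addeA leeDl// adde_ge0//.
  by apply: sup_norm_ge0; [exact: enorm_ge0|exists e].
exact: hoelder_seminorm_ge0 (@enorm_ge0 _ _) Se SNe eNe.
Qed.

End radius_bound.

Theorem proposition2 (R : realType) (d : nat) (d_ge2 : (2 <= d)%N)
    (alpha kappa Lambda : R)
    (alpha01 : 0 < alpha <= 1) (kappa01 : 0 < kappa <= 1)
    (Lambda_gt0 : 0 < Lambda) :
  exists2 C : R, 0 < C &
    forall Omega : set 'rV[R]_d,
      S2alpha_domain alpha kappa Lambda Omega ->
      volume Omega = volume (unit_ball : set 'rV[R]_d) ->
      (C%:E * zolotarev alpha Omega unit_ball ^+ 2
        <= deficit Omega + weighted_deficit Omega)%E.
Proof.
case: d d_ge2 => [//|s] s0; have /andP[a0 _] := alpha01.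
have M0 : 0 <= 1 + Lambda by rewrite addr_ge0// ltW.
have [c c0 cP] := radial_stability s0 M0.
(* The 4 is the square of the factor 2 in the bound of the Zolotarev distance by the volume
   difference. *)
exists (c / 4); first by rewrite divr_gt0.
move=> Omega [_ [oO _ _] _ [rho [rho0 OE _ rhoL]]] vol.
have rhoM x : unit_sphere x -> rho x <= 1 + Lambda.
  move=> Sx; have := sphere_C1alpha_norm_bound rhoL Sx.
  by rewrite ler_norml lerBlDl => /andP[].
have := cP Omega rho oO OE rho0 rhoM vol.
have mB : measurable (unit_ball : set 'rV[R]_s.+1) by exact: measurable_eball.
have mO := open_row_measurable oO.
have Bfin : (0 < volume (unit_ball : set 'rV[R]_s.+1) < +oo)%E.
  by rewrite [volume _]ball_volumeE lte_fin ball_volume_gt0 ltry.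
have Zle := zolotarev_le a0 mO mB vol Bfin.
have Z0 := zolotarev_ge0 alpha Omega unit_ball.
set V := fine _ in Zle *.
have PB : (perimeter (unit_ball : set 'rV[R]_s.+1) <= hausdorff s (@unit_sphere R s.+1))%E.
  by apply: le_hausdorff; exact: boundary_unit_ball.
have PB0 : (0 <= perimeter (unit_ball : set 'rV[R]_s.+1))%E by exact: hausdorff_ge0.
rewrite /deficit /weighted_deficit.
have P0 : (0 <= perimeter Omega)%E by exact: hausdorff_ge0.
have W0 : (0 <= hausdorff_integral s (boundary Omega) (fun x => enorm x ^+ 2)%R)%E.
  rewrite hausdorff_integralE.
  - by apply: integral_ge0 => x _; rewrite lee_fin sqr_ge0.
  - exact: measurable_boundary.
  - by apply: measurable_funX; exact: measurable_enorm.
  - by move=> x; rewrite sqr_ge0.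
have Soo := hausdorff_sphere_lty (R := R) s.
have CZ : ((c / 4)%:E * zolotarev alpha Omega unit_ball ^+ 2 <= (c * V ^+ 2)%:E)%E.
  move: Z0 Zle; case: (zolotarev _ _ _) => [z| |]//; rewrite !lee_fin => z0 zV.
  rewrite -expr2 mulrAC ler_pdivrMr// -mulrA ler_pM2l//.
  have : z ^+ 2 <= (2 * V) ^+ 2 by rewrite lerXn2r ?nnegrE ?(le_trans z0).
  by rewrite exprMn; lra.
move=> main; apply: (le_trans CZ); move: main PB PB0 P0 W0 Soo; clear.
rewrite -/(perimeter Omega).
(* Finiteness of the measure of the sphere makes the perimeter of the ball finite, so the
   subtractions are genuine. If a boundary term of [Omega] is infinite, the right-hand side is
   [+oo]. *)
case: (perimeter unit_ball) => [b| |]; case: (hausdorff _ unit_sphere) => [h| |]//.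
case: (perimeter Omega) => [p| |]//; case: (hausdorff_integral _ _ _) => [w| |]//;
  rewrite ?leey// -?EFinD -?EFinB -?EFinD !lee_fin => *; lra.
Qed.
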